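(* Let $c\ge2$ be an integer and $\lambda>0$. Consider an arbitrary load balancing network with $c$ queues and arrival rate $\lambda$, and let $(X,Y)=(X(t),Y(t))_{t\in\mathbb{R}_+}$ be the pair of processes constructed in the context. Then $(X,Y)$ is a coupling between the queue length process of this load balancing network and the queue length process of the uniform routing (UR) network: $X$ is a queue length process of the load balancing network and $Y$ is a queue length process of the UR network (with respective initial values $X(0)$ and $Y(0)$). Moreover, $$X(0)\preccurlyeq Y(0)\implies X(t)\preccurlyeq Y(t)\ \text{ for all } t\in\mathbb{R}_+ .$$
   Context: Notation: $\mathbb{N}_0=\{0,1,\dots\}$; $(e_i)_{1\le i\le c}$ is the canonical basis of $\mathbb{R}^c$. For $x=(x^i)_{1\le i\le c}\in\mathbb{N}_0^c$, $\beta_n(x)=\sum_{i=1}^c(x^i-n)^+$ for $n\in\mathbb{N}_0$, and $x\preccurlyeq y$ means $\beta_n(x)\le\beta_n(y)$ for all $n\in\mathbb{N}_0$. Load balancing network: $c$ single-server infinite-buffer queues; $X^i(t)$ is the number of tasks in queue $i$ at time $t$, and $X(t)=(X^i(t))_{1\le i\le c}$. Tasks arrive as a Poisson process of rate $\lambda$; services are exponential with rate $1$ and work conserving. The process $X$ is a continuous-time Markov process on $\mathbb{N}_0^c$ (right-continuous paths with left limits). At an arrival instant $t$, an index $j$ is chosen uniformly in $\{1,\dots,c\}$ and the policy determines, possibly at random, an index $i$ with $X^i(t-)\le X^j(t-)$, and $X(t)=X(t-)+e_i$. The total service rate is the number of non-empty queues, and a service completion concerns a queue $j$ chosen uniformly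 among the non-empty ones; the policy then determines, possibly at random, an index $i$ with $X^i(t-)\ge X^j(t-)\ge1$, and $X(t)=X(t-)-e_i$. Equivalently, the policy is given by probability kernels $a(x,j,\cdot)$ supported on $\{i:x^i\le x^j\}$ and, for $x^j\ge1$, $b(x,j,\cdot)$ supported on $\{i:x^i\ge x^j\}$, and $X$ has transition rates $\frac{\lambda}{c}\sum_{j}a(x,j,i)$ from $x$ to $x+e_i$ and $\sum_{j:x^j\ge1}b(x,j,i)$ from $x$ to $x-e_i$. The UR network is the load balancing network in which always $i=j$, so that its queue lengths are $c$ independent $M/M/1$ queue length processes with arrival rate $\lambda/c$ and service rate $1$. Construction of $(X,Y)$. For $x\in\mathbb{N}_0^c$ let $\sigma_x$ be the permutation of $\{1,\dots,c\}$ with $x^{\sigma_x(1)}\le\dots\le x^{\sigma_x(c)}$, ties being broken by ascending index; write $\sigma(t)=\sigma_{X(t)}$ and $\tau(t)=\sigma_{Y(t)}$. Draw $(X(0),Y(0))$ from some joint law. Independently of it and of each other, take a Poisson process of arrivals of intensity $\lambda$ and a Poisson process of potential service completions of intensity $c$, both marked by i.i.d. uniform draws in $\{1,\dots,c\}$. Both networks use the same marked Poisson processes. - At an arrival instant $t$ with mark $k$: the load balancing network uses $j=\sigma(t-)(k)$ as its uniformly chosen queue, and its policy determines (according to $a(X(t-),j,\cdot)$, with randomness independent of the rest) $i$ with $X^i(t-)\le X^{j}(t-)$ and sets $X(t)=X(t-)+e_i$; the UR network sets $Y(t)=Y(t-)+e_{\tau(t-)(k)}$. - At a potential service completion instant $t$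 with mark $k$: with $j=\sigma(t-)(k)$, if $X^j(t-)=0$ then $X(t)=X(t-)$, otherwise the policy determines (according to $b(X(t-),j,\cdot)$, with randomness independent of the rest) $i$ with $X^i(t-)\ge X^j(t-)\ge1$ and $X(t)=X(t-)-e_i$; the UR network sets $Y(t)=Y(t-)-e_{\tau(t-)(k)}$ if $Y^{\tau(t-)(k)}(t-)\ge1$, and $Y(t)=Y(t-)$ otherwise. Between these instants $X$ and $Y$ are constant. *)

(* Defs.v *)
From HB Require Import structures.
From mathcomp Require Export all_boot all_order all_algebra.
From mathcomp Require Export all_classical all_reals all_analysis.
Export Order.TTheory GRing.Theory Num.Theory.
Export numFieldNormedType.Exports.

Set Implicit Arguments.
Unset Strict Implicit.
Unset Printing Implicit Defensive.

Global Open Scope classical_set_scope.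
Global Open Scope ring_scope.

(* Queue states are vectors of N_0^c.  Queues, and the marks of the Poisson
   processes, are numbered from 0 to c - 1. *)
Definition state (c : nat) := {ffun 'I_c -> nat}.

Definition add_task (c : nat) (x : state c) (i : 'I_c) : state c :=
  [ffun k => (x k + (k == i))%N].

(* The subtraction is truncated; it is the vector x - e_i when 1 <= x i. *)
Definition remove_task (c : nat) (x : state c) (i : 'I_c) : state c :=
  [ffun k => (x k - (k == i))%N].

Definition beta (c : nat) (n : nat) (x : state c) : nat :=
  (\sum_(i < c) (x i - n))%N.

Definition preceq (c : nat) (x y : state c) : Prop :=
  forall n : nat, (beta n x <= beta n y)%N.

Definition queue_order (c : nat) (x : state c) : rel 'I_c :=
  fun i j => (x i < x j)%N || ((x i == x j) && (i <= j)%N).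

(* queue_order x is a total order, hence the sorted enumeration is the only one
   and ties are broken by ascending index. *)
Definition sigma (c : nat) (x : state c) (k : 'I_c) : 'I_c :=
  nth k (sort (queue_order x) (enum 'I_c)) k.

(* Policies: a x j i (resp. b x j i) is the probability that a task (resp. a
   service completion) is sent to queue i when queue j has been drawn.
   b x j is meaningful only if queue j is non-empty. *)
Record is_policy (R : realType) (c : nat)
    (a b : state c -> 'I_c -> 'I_c -> R) : Prop := IsPolicy {
  policy_arr_ge0 : forall x j i, 0 <= a x j i ;
  policy_arr_sum : forall x j, \sum_(i < c) a x j i = 1 ;
  policy_arr_supp : forall (x : state c) j i, a x j i != 0 -> (x i <= x j)%N ;
  policy_srv_ge0 : forall (x : state c) j i, (1 <= x j)%N -> 0 <= b x j i ;
  policy_srv_sum : forall (x : state c) j, (1 <= x j)%N -> \sum_(i < c) b x j i = 1 ;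
  policy_srv_supp : forall (x : state c) j i,
    (1 <= x j)%N -> b x j i != 0 -> (x j <= x i)%N }.

(* Uniform routing, used both for arrivals and for service completions. *)
Definition ur_choice (R : realType) (c : nat) (x : state c) (j i : 'I_c) : R :=
  (i == j)%:R.

Lemma ur_is_policy (R : realType) (c : nat) :
  is_policy (@ur_choice R c) (@ur_choice R c).
Proof.
have s1 (j : 'I_c) : \sum_(i < c) (i == j)%:R = 1 :> R.
  by rewrite (bigD1 j) //= eqxx big1 ?addr0 // => i /negbTE ->.
split=> [x j i|x j|x j i|x j i _|x j _|x j i _]; rewrite /ur_choice ?ler0n ?s1 //.
all: by case: (eqVneq i j) => [->|]; rewrite ?leqnn ?eqxx.
Qed.

Definition lb_rate (R : realType) (c : nat) (lam : R)
    (a b : state c -> 'I_c -> 'I_c -> R) (x y : state c) : R :=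
  \sum_(i < c | y == add_task x i) lam / c%:R * (\sum_(j < c) a x j i)
  + \sum_(i < c | x == add_task y i) \sum_(j < c | (1 <= x j)%N) b x j i.

(* Left limits and right-continuity are with respect to the discrete topology
   on the (countable) space of values. *)
Definition left_lim (R : realType) (T : Type) (f : R -> T) (t : R) (x : T)
    : Prop :=
  \forall s \near t^'-, f s = x.

Definition cadlag (R : realType) (T : Type) (f : R -> T) : Prop :=
  (forall t : R, 0 <= t -> \forall s \near t^'+, f s = f t) /\
  (forall t : R, 0 < t -> exists x, left_lim f t x).

Definition discrete_rv (d : measure_display) (Omega : measurableType d)
    (T : Type) (V : Omega -> T) : Prop :=
  forall x : T, measurable (V @^-1` [set x]).

(* The sigma-algebra generated by the variables V j, j in D, with values in a
   countable set. *)
Definition sigma_gen (Omega J T : Type) (D : set J) (V : J -> Omega -> T)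
    : set (set Omega) :=
  <<s [set E | exists2 j, D j & exists B : set T, E = V j @^-1` B] >>.

Definition mutually_independent (d : measure_display)
    (Omega : measurableType d) (R : realType) (P : probability Omega R)
    (I : Type) (F : I -> set (set Omega)) : Prop :=
  forall (n : nat) (i : 'I_n -> I) (E : 'I_n -> set Omega),
    injective i -> (forall k, F (i k) (E k)) ->
    P (\big[setI/setT]_(k < n) E k) = (\prod_(k < n) P (E k))%E.

(* Continuous-time Markov processes on a countable set, with prescribed
   transition rates. *)

Record transition_function (R : realType) (S : choiceType)
    (p : R -> S -> S -> R) : Prop := TransitionFunction {
  trans_ge0 : forall (t : R) x y, 0 <= t -> 0 <= p t x y ;
  trans_sum : forall (t : R) x, 0 <= t ->
    \esum_(y in [set: S]) (p t x y)%:E = 1%E ;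
  trans_0 : forall x y, p 0 x y = (x == y)%:R ;
  trans_chapman_kolmogorov : forall (s t : R) x z, 0 <= s -> 0 <= t ->
    (p (s + t) x z)%:E = \esum_(y in [set: S]) (p s x y * p t y z)%:E }.

(* The values of q on the diagonal are irrelevant: the exit rate from x is the
   sum of the rates towards the other states. *)
Record has_rates (R : realType) (S : choiceType)
    (p : R -> S -> S -> R) (q : S -> S -> R) : Prop := HasRates {
  rates_jump : forall x y, x != y -> p h x y / h @[h --> 0^'+] --> q x y ;
  rates_exit : forall x,
    ((1 - p h x x) / h)%:E @[h --> 0^'+]
      --> \esum_(y in [set y | y != x]) (q x y)%:E }.

(* The Markov property is with respect to the natural filtration of X. *)
Record markov_process (d : measure_display) (Omega : measurableType d)
    (R : realType) (P : probability Omega R) (S : choiceType)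
    (q : S -> S -> R) (X : R -> Omega -> S) : Prop := MarkovProcess {
  markov_rv : forall t : R, 0 <= t -> discrete_rv (X t) ;
  markov_cadlag : \forall w \ae P, cadlag (X ^~ w) ;
  markov_property : exists p : R -> S -> S -> R,
    [/\ transition_function p, has_rates p q &
      forall (s t : R) (E : set Omega) (x y : S), 0 <= s -> 0 <= t ->
        sigma_gen [set u | 0 <= u <= s] X E ->
        (P (E `&` [set w | X s w = x] `&` [set w | X (s + t)%R w = y])
         = P (E `&` [set w | X s w = x]) * (p t x y)%:E)%E] }.

Definition lb_queue_length_process (d : measure_display)
    (Omega : measurableType d) (R : realType) (P : probability Omega R)
    (c : nat) (lam : R) (a b : state c -> 'I_c -> 'I_c -> R)
    (X : R -> Omega -> state c) : Prop :=
  markov_process P (lb_rate lam a b) X.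

Definition ur_queue_length_process (d : measure_display)
    (Omega : measurableType d) (R : realType) (P : probability Omega R)
    (c : nat) (lam : R) (Y : R -> Omega -> state c) : Prop :=
  lb_queue_length_process P lam (@ur_choice R c) (@ur_choice R c) Y.

(* Poisson processes, given by their counting processes. *)

(* n is the number of points before t *)
Definition point_at (R : realType) (N : R -> nat) (t : R) (n : nat) : Prop :=
  [/\ 0 < t, left_lim N t n & N t = n.+1].

Record counting_path (R : realType) (N : R -> nat) : Prop := CountingPath {
  counting_0 : N 0 = 0%N ;
  counting_mono : forall s t : R, 0 <= s -> s <= t -> (N s <= N t)%N ;
  counting_cadlag : cadlag N ;
  counting_unit_jumps : forall (t : R) n,
    0 < t -> left_lim N t n -> N t = n \/ N t = n.+1 }.

Record poisson_process (d : measure_display) (Omega : measurableType d)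
    (R : realType) (P : probability Omega R) (rate : R)
    (N : R -> Omega -> nat) : Prop := PoissonProcess {
  poisson_rv : forall t : R, 0 <= t -> discrete_rv (N t) ;
  poisson_path : \forall w \ae P, counting_path (N ^~ w) ;
  poisson_increment_law : forall (s t : R) k, 0 <= s -> s < t ->
    P [set w | N t w = (N s w + k)%N] = (poisson_pmf (rate * (t - s)) k)%:E ;
  poisson_indep_increments : forall (n : nat) (t : nat -> R) (k : nat -> nat),
    0 <= t 0%N -> (forall m, t m < t m.+1) ->
    (P (\big[setI/setT]_(m < n) [set w | N (t m.+1) w = (N (t m) w + k m)%N])
     = \prod_(m < n) P [set w | N (t m.+1) w = (N (t m) w + k m)%N])%E }.

(* The independent sources of randomness: the joint initial value, the two
   point processes, and, for the n-th point of each of them, its mark and the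
   choices of the policy. *)
Variant source : Type :=
  | Initial
  | Arrivals | ArrivalMark of nat | ArrivalChoice of nat
  | Services | ServiceMark of nat | ServiceChoice of nat.

Definition source_sigma (R : realType) (c : nat) (Omega : Type)
    (NA NS : R -> Omega -> nat) (K L : nat -> Omega -> 'I_c)
    (A B : nat -> state c -> 'I_c -> Omega -> 'I_c)
    (X Y : R -> Omega -> state c) (r : source) : set (set Omega) :=
  match r with
  | Initial => sigma_gen [set: unit] (fun _ w => (X 0 w, Y 0 w))
  | Arrivals => sigma_gen [set t | 0 <= t] NA
  | ArrivalMark n => sigma_gen [set: unit] (fun=> K n)
  | ArrivalChoice n =>
      sigma_gen [set: state c * 'I_c] (fun xj => A n xj.1 xj.2)
  | Services => sigma_gen [set t | 0 <= t] NS
  | ServiceMark n => sigma_gen [set: unit] (fun=> L n)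
  | ServiceChoice n =>
      sigma_gen [set xj : state c * 'I_c | (1 <= xj.1 xj.2)%N]
        (fun xj => B n xj.1 xj.2)
  end.

(* The dynamics, for a given outcome.  At the arrival instant t preceded by n
   arrivals, the mark is K n and the policy sends the task to queue A n x j when
   the state is x and the chosen queue is j; similarly for the potential service
   completions, with L and B. *)
Record coupled_path (R : realType) (c : nat)
    (NA NS : R -> nat) (K L : nat -> 'I_c)
    (A B : nat -> state c -> 'I_c -> 'I_c)
    (X Y : R -> state c) : Prop := CoupledPath {
  path_arrival : forall t n, point_at NA t n ->
    exists x y, [/\ left_lim X t x, left_lim Y t y,
      X t = add_task x (A n x (sigma x (K n))) &
      Y t = add_task y (sigma y (K n))] ;
  path_service : forall t n, point_at NS t n ->
    exists x y, [/\ left_lim X t x, left_lim Y t y,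
      X t = (let j := sigma x (L n) in
             if x j == 0%N then x else remove_task x (B n x j)) &
      Y t = (let j := sigma y (L n) in
             if (1 <= y j)%N then remove_task y j else y)] ;
  path_constant : forall s t : R, 0 <= s -> s <= t ->
    NA s = NA t -> NS s = NS t -> X s = X t /\ Y s = Y t }.

(* The policy's randomness is given by independent random maps A n and B n with
   one-point laws a and b; the joint law of A n x j for different (x, j) does
   not matter, since only one of these variables is used. *)
Record coupling_construction (d : measure_display) (Omega : measurableType d)
    (R : realType) (P : probability Omega R) (c : nat) (lam : R)
    (a b : state c -> 'I_c -> 'I_c -> R)
    (NA NS : R -> Omega -> nat) (K L : nat -> Omega -> 'I_c)
    (A B : nat -> state c -> 'I_c -> Omega -> 'I_c)
    (X Y : R -> Omega -> state c) : Prop := CouplingConstruction {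
  constr_X_rv : forall t : R, 0 <= t -> discrete_rv (X t) ;
  constr_Y_rv : forall t : R, 0 <= t -> discrete_rv (Y t) ;
  constr_arrivals : poisson_process P lam NA ;
  constr_services : poisson_process P c%:R NS ;
  constr_arrival_mark_rv : forall n, discrete_rv (K n) ;
  constr_arrival_mark_law : forall n k,
    P [set w | K n w = k] = (c%:R^-1)%:E ;
  constr_service_mark_rv : forall n, discrete_rv (L n) ;
  constr_service_mark_law : forall n k,
    P [set w | L n w = k] = (c%:R^-1)%:E ;
  constr_arrival_choice_rv : forall n x j, discrete_rv (A n x j) ;
  constr_arrival_choice_law : forall n x j i,
    P [set w | A n x j w = i] = (a x j i)%:E ;
  constr_service_choice_rv : forall n (x : state c) j, (1 <= x j)%N ->
    discrete_rv (B n x j) ;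
  constr_service_choice_law : forall n (x : state c) j i, (1 <= x j)%N ->
    P [set w | B n x j w = i] = (b x j i)%:E ;
  constr_independent :
    mutually_independent P (source_sigma NA NS K L A B X Y) ;
  constr_dynamics : \forall w \ae P,
    coupled_path (NA ^~ w) (NS ^~ w) (K ^~ w) (L ^~ w)
      (fun n x j => A n x j w) (fun n x j => B n x j w) (X ^~ w) (Y ^~ w) }.

(* Main.v *)
(* Both processes are jump processes driven by marked Poisson clocks.  On a grid
   of small mesh such a process is compared with the chain that allows at most one
   point of the clocks in each grid interval: by independence of the increments
   and of the marks, the probability of a trajectory of this chain is an explicit
   product, and the probability that some interval contains two points tends to 0
   with the mesh.  In the limit, the finite-dimensional laws are those of the
   semigroup obtained by uniformization, and a monotone class argument extends
   this to the natural filtration.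
   The preorder is preserved by each jump: if beta n x = beta n y, then comparing
   beta at a neighbouring level compares the numbers of queues of x and y above
   that level, hence also the k-th smallest queues with that level. *)
From HB Require Import structures.
Require Import Defs.
From mathcomp Require Import zify ring lra.

Set Implicit Arguments.
Unset Strict Implicit.
Unset Printing Implicit Defensive.

(** * Order statistics and the preorder *)

Section queue_orders.
Variable c : nat.
Implicit Types (x y : state c) (i j k l : 'I_c) (n : nat).

(** [X] and [Y] are given only through almost sure conditions on their paths, and the transition
    function with its rates has to be produced. Grids with at most one point per interval answer the
    first difficulty: there the new state is a function of the old one, of the clock that moved and
    of its next mark, so that neither jump times nor the order of points of different clocks enter,
    and the state at which each mark is read is known along a trajectory. Uniformization answers the
    second: the total rate, here [lam + c], is the same in every state once potential services at
    empty queues are kept as jumps that change nothing. The probability of two points in an interval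
    is then bounded uniformly in the state, and the same quantity controls the distance from the
    grid chain to the semigroup. The Markov property is proved for a generic marked jump process and
    applied to each network. *)

Lemma queue_order_total x : total (queue_order x).
Proof. by move=> i j; rewrite /queue_order; lia. Qed.

Lemma queue_order_trans x : transitive (queue_order x).
Proof. by move=> i j k; rewrite /queue_order; lia. Qed.

Lemma sigmaE x j k :
  sigma x k = nth j (sort (queue_order x) (enum 'I_c)) k.
Proof. by apply: set_nth_default; rewrite size_sort size_enum_ord. Qed.

Lemma sigma_inj x : injective (sigma x).
Proof.
move=> k l; rewrite (sigmaE x k l) (sigmaE x k k) => /eqP.
by rewrite nth_uniq ?size_sort ?size_enum_ord ?sort_uniq ?enum_uniq// => /eqP/val_inj.
Qed.

Lemma sigma_mono x k l : (k <= l)%N -> (x (sigma x k) <= x (sigma x l))%N.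
Proof.
move=> kl; rewrite (sigmaE x k l) (sigmaE x k k).
have refl : reflexive (queue_order x) by move=> i; rewrite /queue_order; lia.
have := sorted_leq_nth (@queue_order_trans x) refl k
  (sort_sorted (@queue_order_total x) (enum 'I_c)).
move=> /(_ k l); rewrite !inE size_sort size_enum_ord => /(_ _ _ kl).
move=> /(_ (ltn_ord k) (ltn_ord l)) /orP[/ltnW//|/andP[/eqP->]]//.
Qed.

(** The entries at ranks [k] to [c - 1], counted from 0, are [c - k] in number and all reach [n] if
    the k-th one does; otherwise only ranks after [k] can reach it. Ranks thus give way to counts,
    which [betaS] relates to the preorder. *)
Lemma card_queues_ge x k n :
  (n <= x (sigma x k))%N = (c <= k + #|[pred i | n <= x i]|)%N.
Proof.
have -> : #|[pred i | n <= x i]%N| = #|[pred l | n <= x (sigma x l)]%N|.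
  rewrite (card_preim (@sigma_inj x) [pred i | n <= x i]%N).
  by apply: eq_card => i; rewrite !inE injF_onto//; exact: sigma_inj.
have L m : (m <= c)%N -> #|[pred l : 'I_c | (l < m)%N]| = m.
  move=> mc; rewrite -sum1_card -[RHS]card_ord -sum1_card.
  by rewrite (big_ord_widen_cond _ xpredT (fun=> 1%N) mc).
have [nx|nx] := leqP n (x (sigma x k)); apply/esym.
  have : (#|[predC [pred l : 'I_c | (l < k)%N]]| <= #|[pred l | n <= x (sigma x l)]%N|)%N.
    apply: subset_leq_card; apply/fintype.subsetP => l; rewrite !inE -leqNgt => kl.
    apply: (leq_trans nx); exact: sigma_mono.
  have := cardC [pred l : 'I_c | (l < k)%N].
  by rewrite L ?(ltnW (ltn_ord k))// card_ord => E le1; rewrite -[X in (X <= _)%N]E leq_add2l le1.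
have : (#|[pred l | n <= x (sigma x l)]%N| <= #|[predC [pred l : 'I_c | (l < k.+1)%N]]|)%N.
  apply: subset_leq_card; apply/fintype.subsetP => l; rewrite !inE -leqNgt => nl.
  rewrite ltnNge; apply/negP => /(sigma_mono x) xl.
  by have := leq_trans nl xl; rewrite leqNgt nx.
have := cardC [pred l : 'I_c | (l < k.+1)%N].
rewrite L// card_ord => E le1; have := ltn_ord k; move: #|_| #|_| E le1 => u v; lia.
Qed.

Lemma betaS n x : beta n x = (beta n.+1 x + #|[pred i | n < x i]|)%N.
Proof.
rewrite /beta -sum1_card [X in (_ + X)%N]big_mkcond -big_split; apply: eq_bigr => i _ /=.
by rewrite !inE; case: ifP; lia.
Qed.

Lemma beta_add_task n x i : beta n (add_task x i) = (beta n x + (n <= x i))%N.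
Proof.
rewrite /beta (bigD1 i)//= [in RHS](bigD1 i)//= ffunE eqxx.
under eq_bigr => j /negbTE ji do rewrite ffunE ji addn0.
by case: leqP; lia.
Qed.

Lemma beta_remove_task n x i : beta n (remove_task x i) = (beta n x - (n < x i))%N.
Proof.
rewrite /beta (bigD1 i)//= [in RHS](bigD1 i)//= ffunE eqxx.
under eq_bigr => j /negbTE ji do rewrite ffunE ji subn0.
by case: ltnP; lia.
Qed.

(* If the k-th smallest entry of x reaches n + 1 while that of y does not, then
   beta decreases from n to n + 1 by at least c - k for x and by less for y. *)
Lemma preceq_add_task x y i k : (x i <= x (sigma x k))%N ->
  preceq x y -> preceq (add_task x i) (add_task y (sigma y k)).
Proof.
(* At level 0 an arrival adds one on both sides; the other levels are compared with the level
   below. *)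
move=> xi xy [|n]; rewrite !beta_add_task; first by have := xy 0%N; lia.
have := xy n; have := xy n.+1; rewrite (betaS n x) (betaS n y).
have := card_queues_ge x k n.+1; have := card_queues_ge y k n.+1.
by lia.
Qed.

(** The inequality could fail only if [y] loses a task above level [n] and [x] does not. Then fewer
    than [c - k] queues of [x] exceed [n], against at least [c - k] of [y], and the inequality at
    level [n + 1] makes the one at level [n] strict. As [remove_task] truncates, empty queues are
    covered. *)
Lemma preceq_remove_task x y i k : (x (sigma x k) <= x i)%N ->
  preceq x y -> preceq (remove_task x i) (remove_task y (sigma y k)).
Proof.
move=> xi xy n; rewrite !beta_remove_task.
have := xy n; have := xy n.+1; rewrite (betaS n x) (betaS n y).
have := card_queues_ge x k n.+1; have := card_queues_ge y k n.+1.
by lia.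
Qed.

End queue_orders.

(** * Paths driven by counting processes *)

Lemma at_rightP (R : realFieldType) (t : R) (P : R -> Prop) :
  (\forall u \near t^'+, P u) <-> exists2 e, t < e & forall u, t < u < e -> P u.
Proof.
split=> [/nbhs_ballP[e /= e0 tP]|[e te tP]].
  exists (t + e); rewrite ?ltrDl// => u /andP[tu ue]; apply: tP => //.
  by rewrite /ball/= ltr_distlC; apply/andP; lra.
have: \forall u \near t^'+, t < u < e.
  by near=> u; apply/andP; split; near: u; [exact: nbhs_right_gt|exact: nbhs_right_lt].
by apply: filterS.
Unshelve. all: by end_near. Qed.

Lemma at_leftP (R : realFieldType) (t : R) (P : R -> Prop) :
  (\forall u \near t^'-, P u) <-> exists2 e, e < t & forall u, e < u < t -> P u.
Proof.
split=> [/nbhs_ballP[e /= e0 tP]|[e te tP]].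
  exists (t - e); rewrite ?gtrBl// => u /andP[tu ue]; apply: tP => //.
  by rewrite /ball/= ltr_distlC; apply/andP; lra.
have: \forall u \near t^'-, e < u < t.
  by near=> u; apply/andP; split; near: u; [exact: nbhs_left_gt|exact: nbhs_left_lt].
by apply: filterS.
Unshelve. all: by end_near. Qed.

(* f b n x is the state reached from x at the point of N b that is preceded by n
   points. *)
Record driven_path (R : realType) (B : finType) (S : Type)
    (N : B -> R -> nat) (f : B -> nat -> S -> S) (X : R -> S) : Prop := DrivenPath {
  driven_counting : forall b, counting_path (N b) ;
  driven_jump : forall b t n, point_at (N b) t n ->
    exists2 x, left_lim X t x & X t = f b n x ;
  driven_constant : forall s t : R, 0 <= s -> s <= t ->
    (forall b, N b s = N b t) -> X s = X t }.

Section driven_paths.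
Variables (R : realType) (B : finType) (S : Type).
Variables (N : B -> R -> nat) (f : B -> nat -> S -> S) (X : R -> S).
Hypothesis dX : driven_path N f X.

Let N_mono b (s t : R) : 0 <= s -> s <= t -> (N b s <= N b t)%N.
Proof. by case: (driven_counting dX b) => _ + _ _; apply. Qed.

Let total t := (\sum_b N b t)%N.

Let total_mono (s t : R) : 0 <= s -> s <= t -> (total s <= total t)%N.
Proof. by move=> s0 st; apply: leq_sum => b _; exact: N_mono. Qed.

Let driven_total_eq (s t : R) : 0 <= s -> s <= t ->
  (\sum_b N b t <= \sum_b N b s)%N -> forall b, N b s = N b t.
Proof.
move=> s0 st + b; rewrite (bigD1 b)//= [X in (_ <= X)%N](bigD1 b)//=.
have := N_mono b s0 st.
have : (\sum_(i | i != b) N i s <= \sum_(i | i != b) N i t)%N.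
  by apply: leq_sum => i _; exact: N_mono.
lia.
Qed.

Let right_constant (t : R) : 0 <= t ->
  exists2 e, t < e & forall u, t < u < e -> forall b, N b u = N b t.
Proof.
move=> t0; apply/at_rightP; apply: filter_forall => b.
by have [_ _ [/(_ t t0)]] := driven_counting dX b.
Qed.

Let left_constant (t : R) : 0 < t ->
  exists n : B -> nat, \forall u \near t^'-, forall b, N b u = n b.
Proof.
move=> t0.
have /boolp.choice[n nP] b : exists n, left_lim (N b) t n.
  by have [_ _ [_ /(_ t t0)]] := driven_counting dX b.
by exists n; apply: filter_forall => b; exact: nP.
Qed.

Lemma driven_cadlag : cadlag X.
Proof.
split=> [t t0|t t0].
  have [e te eP] := right_constant t0; apply/at_rightP; exists e => // u ue.
  apply/esym/(driven_constant dX) => // [|b]; last by rewrite eP.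
  by case/andP: ue => /ltW.
have [n /at_leftP[e et eP]] := left_constant t0.
pose v := (Num.max e 0 + t) / 2.
have v0 : Num.max e 0 < t by rewrite gt_max et.
have vP : Num.max e 0 < v < t by rewrite /v midf_lt// ?midf_lt.
have {v0 vP} [ev v0 vt] : [/\ e < v, 0 < v & v < t].
  by move: vP; rewrite gt_max => /andP[/andP[]].
have eqv u : v <= u < t -> X v = X u.
  move=> /andP[vu ut]; apply: (driven_constant dX) => // [|b]; first exact: ltW.
  by rewrite !eP// ?ev ?ut ?andbT//= (lt_le_trans ev).
exists (X v); apply/at_leftP; exists v => // u /andP[vu ut].
by rewrite -eqv// ut ltW.
Qed.

(** The last jump time is the infimum of the times of [[s, t]] at which the total count already has
    its final value; [u] is taken just before it, where counts and state agree with their left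
    limits. If several clocks jump there, any of them may serve as [b]. *)
Lemma last_jump (s t : R) : 0 <= s -> s <= t -> (exists b, N b s != N b t) ->
  exists b u, [/\ s <= u, u <= t, N b t = (N b u).+1 & X t = f b (N b u) (X u)].
Proof.
move=> s0 st [b0 Nst].
have lt_total : (total s < total t)%N.
  by rewrite ltnNge; apply: contra Nst => /(driven_total_eq s0 st) /(_ b0) ->.
pose E := [set u | s <= u <= t /\ total u = total t].
have tE : E t by split=> //; rewrite st lexx.
have E_lb : has_lbound E by exists s => u [/andP[]].
have E_inf : has_inf E by split=> //; exists t.
pose r := inf E.
have sr : s <= r by apply: lb_le_inf; [exists t|move=> u [/andP[]]].
have rt : r <= t by exact: inf_lbound.
have r0 := le_trans s0 sr.
have total_r : total r = total t.
  (* By right-continuity, the infimum is attained. *)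
  have [e re eP] := right_constant r0.
  have [|u [/andP[su ut] totu] ue] := @inf_adherent _ E (e - r) _ E_inf.
    by rewrite subr_gt0.
  rewrite addrC subrK in ue.
  have : r <= u by apply: inf_lbound => //; split; rewrite ?su ?ut.
  rewrite le_eqVlt => /predU1P[->//|ru].
  by rewrite -totu /total; apply: eq_bigr => b _; rewrite eP// ru.
have s_lt_r : s < r.
  by rewrite lt_neqAle sr andbT; apply: contraTneq lt_total => ->; rewrite total_r ltnn.
have before_r u : s <= u -> u < r -> (total u < total t)%N.
  move=> su ur; have ut := ltW (lt_le_trans ur rt).
  rewrite ltn_neqAle total_mono ?(le_trans s0)// andbT.
  apply: contraTneq ur => tot_u; rewrite -leNgt; apply: inf_lbound => //.
  by split=> //; rewrite su.
have [n nP] := left_constant (le_lt_trans s0 s_lt_r).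
have /at_leftP[e er eP] := nP.
have near_r v : v < r -> exists u, [/\ s <= u, v < u & u < r].
  move=> vr; exists ((Num.max s v + r) / 2).
  have : Num.max s v < r by rewrite gt_max s_lt_r.
  have [sm vm] : s <= Num.max s v /\ v <= Num.max s v by split; rewrite le_max lexx ?orbT.
  by move=> mr; split; lra.
have [b nb] : exists b, N b r <> n b.
  apply: contrapT => /forallNP nN; have [u [su eu ur]] := near_r e er.
  have := before_r u su ur; rewrite -total_r (_ : total u = total r) ?ltnn//.
  apply: eq_bigr => b _; rewrite (eP u) ?eu ?ur//; apply/esym; apply: contrapT; exact: nN.
have left_b : left_lim (N b) r (n b) by apply: filterS nP => u; exact.
have [_ _ _ /(_ r (n b) (le_lt_trans s0 s_lt_r) left_b)[//|Nbr]] := driven_counting dX b.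
have [x /at_leftP[e' er' xP] Xr] : exists2 x, left_lim X r x & X r = f b (n b) x.
  by apply: (driven_jump dX); split=> //; exact: le_lt_trans s_lt_r.
have [u [su]] : exists u, [/\ s <= u, Num.max e e' < u & u < r].
  by apply: near_r; rewrite gt_max er.
rewrite gt_max => /andP[eu e'u] ur.
have Nrt b' : N b' r = N b' t by apply: driven_total_eq => //; rewrite -/(total t) -/(total r) total_r.
have Nbu : N b u = n b by rewrite eP ?eu.
exists b, u; split=> //; rewrite ?(le_trans (ltW ur))// Nbu -?Nrt//.
by rewrite -(driven_constant dX r0 rt Nrt) Xr xP ?e'u.
Qed.

(** This frees the grid argument from jump times: the last jump can only be the one of [b], and
    nothing has moved before it, so the state there is still [X s]. *)
Lemma single_jump (s t : R) b : 0 <= s -> s <= t ->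
  N b t = (N b s).+1 -> (forall b', b' != b -> N b' t = N b' s) ->
  X t = f b (N b s) (X s).
Proof.
move=> s0 st Nb Nb'; have [|b1 [u [su ut Nu ->]]] := last_jump s0 st.
  by exists b; rewrite Nb neq_ltn ltnSn.
have b1b : b1 = b.
  apply/eqP/negP => /negP /Nb'; rewrite Nu.
  by have := N_mono b1 s0 su; lia.
subst b1; have Nub : N b u = N b s by lia.
rewrite Nub; congr f; apply/esym/(driven_constant dX) => // b1.
have [->//|/Nb' b1t] := eqVneq b1 b; apply/eqP.
have := N_mono b1 s0 su; have := N_mono b1 (le_trans s0 su) ut; lia.
Qed.

Lemma driven_invariant (I : S -> Prop) :
  (forall b n x, I x -> I (f b n x)) -> I (X 0) -> forall t, 0 <= t -> I (X t).
Proof.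
move=> If I0 t; have [n] := ubnP (total t); elim: n t => // n IH t tn t0.
have [/forallP N0|] := boolP [forall b, N b 0 == N b t].
  by rewrite -(driven_constant dX (lexx 0) t0)// => b; apply/eqP.
rewrite negb_forall => /existsP/(last_jump (lexx 0) t0)[b [u [u0 ut Nt ->]]].
apply/If/IH => //; have := total_mono u0 ut.
rewrite leq_eqVlt => /predU1P[tot|]; last by move: tn; lia.
by have := driven_total_eq u0 ut _ b; rewrite -/(total u) tot => /(_ (leqnn _)); lia.
Qed.

End driven_paths.

(** * Uniformization of bounded rates *)

Lemma esumZl (R : realType) (T : choiceType) (I : set T) (k : R) (a : T -> \bar R) :
  0 <= k -> (forall i, 0 <= a i)%E ->
  (\esum_(i in I) (k%:E * a i) = k%:E * \esum_(i in I) a i)%E.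
Proof.
move=> k0 a0; rewrite -ereal_supZl//; last first.
  by apply/set0P; exists 0%E, set0; [exact: fsets_set0|rewrite fsbig_set0].
congr ereal_sup; rewrite image_comp; apply: eq_imagel => A _ /=.
by rewrite ge0_mule_fsumr.
Qed.

Lemma esum_delta (R : realType) (T : choiceType) (x : T) (g : T -> R) :
  (forall y, 0 <= g y) -> \esum_(y in [set: T]) ((x == y)%:R * g y)%:E = (g x)%:E.
Proof.
move=> g0; rewrite -[RHS](@esum_set1 _ _ x (fun y => (g y)%:E)) ?lee_fin//.
rewrite [RHS]esum_mkcond; apply: eq_esum => y _.
by have [->|/eqP yx] := eqVneq y x; rewrite ?mul1r ?mul0r; [rewrite mem_set|rewrite memNset].
Qed.

Lemma esum_cauchy (R : realType) (F : nat -> nat -> \bar R) :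
  (forall n m, 0 <= F n m)%E ->
  (\esum_(n in [set: nat]) \esum_(m in [set: nat]) F n m =
   \esum_(k in [set: nat]) \sum_(n < k.+1) F n (k - n)%N)%E.
Proof.
move=> F0.
have E k : (\sum_(n < k.+1) F n (k - n)%N =
    \esum_(n in `I_k.+1) F n (k - n)%N)%E.
  by rewrite (fsbig_ord _ _ (fun n => F n (k - n)%N)) esum_fset//; exact: finite_II.
under [RHS]eq_esum do rewrite E.
rewrite !esum_esum//.
rewrite (reindex_esum ([set: nat] `*`` (fun k => `I_k.+1)) _
  (fun kn : nat * nat => (kn.2, kn.1 - kn.2)%N))//.
split=> [[k n] //=|[k n] [k' n']|[n m] _] /=.
- by rewrite !inE /= => -[_ nk] [_ nk'] [nn]; move: nk nk'; rewrite nn => ? ? ?; congr pair; lia.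
- by exists (n + m, n)%N; rewrite /= ?leq_addr ?addKn.
Qed.

Lemma big_option (V : nmodType) (J : finType) (F : option J -> V) :
  \sum_j F j = F None + \sum_j F (Some j).
Proof.
rewrite (bigD1 None)//=; congr (_ + _); rewrite (reindex_omap Some id) => [|[]//].
by apply: eq_bigl => j; rewrite eqxx.
Qed.

Section kernel_operators.
Variables (R : realType) (S : choiceType) (J : finType).
Variables (w : J -> S -> R) (psi : J -> S -> S).

Definition kernel_op (f : S -> R) (x : S) : R := \sum_j w j x * f (psi j x).

Hypothesis w0 : forall j x, 0 <= w j x.

Lemma kernel_op_ge0 n f : (forall x, 0 <= f x) -> forall x, 0 <= iter n kernel_op f x.
Proof.
move=> f0; elim: n => // n IH x /=.
by apply: sumr_ge0 => j _; rewrite mulr_ge0.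
Qed.

Lemma kernel_op_le n f g : (forall x, 0 <= f x <= g x) ->
  forall x, iter n kernel_op f x <= iter n kernel_op g x.
Proof.
move=> fg; elim: n => [|n IH] x /=; first by case/andP: (fg x).
by apply: ler_sum => j _; rewrite ler_wpM2l.
Qed.

(** The iterates applied to indicators are the entries of the powers of a matrix, and the operator
    is recovered by expanding [g] over indicators. When [g] is itself such an entry, this is the
    product of two powers. *)
Lemma kernel_op_esum n g x : (forall y, 0 <= g y) ->
  \esum_(y in [set: S]) (iter n kernel_op (fun z => (z == y)%:R) x * g y)%:E =
  (iter n kernel_op g x)%:E.
Proof.
move=> g0; elim: n x => [|n IH] x /=; first exact: esum_delta.
have it0 m z y : 0 <= iter m kernel_op (fun z0 => (z0 == y)%:R : R) z.
  by apply: kernel_op_ge0.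
rewrite {2}/kernel_op -sumEFin.
under [in RHS]eq_bigr => j _.
  rewrite EFinM -IH -esumZl//; last by move=> y; rewrite lee_fin mulr_ge0.
  over.
rewrite -esum_sum/=; last by move=> y j _ _; rewrite lee_fin !mulr_ge0.
apply: eq_esum => y _; rewrite sumEFin; congr EFin.
by rewrite mulr_suml; apply: eq_bigr => j _; rewrite mulrA.
Qed.

Lemma kernel_op_const n (L : R) x : (forall x, \sum_j w j x = L) ->
  iter n kernel_op (fun=> 1) x = L ^+ n.
Proof.
move=> wL; elim: n x => //= n IH x; rewrite /kernel_op.
by under eq_bigr do rewrite IH; rewrite -mulr_suml wL exprS.
Qed.

End kernel_operators.

(** The right-hand side is the probability that a Poisson variable of mean [u] is at most 1; the
    bound is [expR (- u) >= 1 - u] multiplied by [1 + u]. *)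
Lemma one_sub_sqr_le_expRN (R : realType) (u : R) :
  0 <= u -> 1 - u ^+ 2 <= expR (- u) * (1 + u).
Proof.
move=> u0; have := expR_ge1Dx (- u); move: (expR (- u)) => e eu.
by rewrite (_ : 1 - u ^+ 2 = (1 - u) * (1 + u)); [apply: ler_wpM2r => //; lra|ring].
Qed.

Lemma kernel_opZ (R : realType) (S : choiceType) (J : finType) (w : J -> S -> R) psi n
    (c : R) f x :
  iter n (kernel_op w psi) (fun y => c * f y) x = c * iter n (kernel_op w psi) f x.
Proof.
elim: n x => //= n IH x; rewrite /kernel_op mulr_sumr; apply: eq_bigr => j _.
by rewrite IH mulrCA.
Qed.

Section uniformization.
Variables (R : realType) (S : choiceType) (J : finType).
Variables (w : J -> S -> R) (psi : J -> S -> S) (L : R).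
Hypothesis L_gt0 : 0 < L.
Hypothesis w0 : forall j x, 0 <= w j x.
Hypothesis wL : forall x, \sum_j w j x = L.

Let A := kernel_op w psi.
Let a n x y := iter n A (fun z => (z == y)%:R) x.
Let c t n := expR (- (L * t)) * t ^+ n / n`!%:R.

(** This is the exponential of [t (A - L)], expanded in powers of the nonnegative matrix [A], whose
    rows sum to [L]; the powers of [L] in the usual Poisson weights are left inside those of [A].
    For [t >= 0] the series is at most 1, so that [fine] loses nothing. *)
Definition unif_trans (t : R) (x y : S) : R :=
  fine (\esum_(n in [set: nat]) (c t n * a n x y)%:E).

Local Notation p := unif_trans.

Let a0 n x y : 0 <= a n x y.
Proof. exact: kernel_op_ge0. Qed.

Let c0 t n : 0 <= t -> 0 <= c t n.
Proof. by move=> t0; rewrite /c divr_ge0// mulr_ge0 ?expR_ge0 ?exprn_ge0. Qed.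

Let c_sum t : 0 <= t -> \esum_(n in [set: nat]) (c t n * L ^+ n)%:E = 1%E.
Proof.
rewrite le_eqVlt => /predU1P[<-|t0].
  rewrite -[RHS](@esum_delta R nat 0%N (fun=> 1))//.
  apply: eq_esum => n _; rewrite /c mulr0 oppr0 expR0 mul1r mulr1 expr0n.
  by have [->|] := eqVneq n 0%N; rewrite ?mul0r// fact0 divr1 mulr1.
have <- : \esum_(n in [set: nat]) (poisson_pmf (L * t) n)%:E = 1%E.
  have : poisson_prob (L * t) 0 [set: nat] = 1%E by exact: probability_setT.
  by rewrite /poisson_prob mulr_gt0.
apply: eq_esum => n _; congr EFin.
by rewrite /c /poisson_pmf mulr_gt0// exprMn; ring.
Qed.

Let a_sum n x : \esum_(y in [set: S]) (a n x y)%:E = (L ^+ n)%:E.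
Proof.
rewrite -(kernel_op_const psi n x wL) -kernel_op_esum//.
by apply: eq_esum => y _; rewrite mulr1.
Qed.

Let a_comp n m x z : \esum_(y in [set: S]) (a n x y * a m y z)%:E = (a (n + m) x z)%:E.
Proof. by rewrite kernel_op_esum; [rewrite /a iterD|exact: w0|move=> y; exact: a0]. Qed.

Let a_le n x y : a n x y <= L ^+ n.
Proof.
rewrite -(kernel_op_const psi n x wL); apply: kernel_op_le => // z.
by rewrite ler0n lern1 leq_b1.
Qed.

Let ca0 t n x y : 0 <= t -> (0 <= (c t n * a n x y)%:E)%E.
Proof. by move=> t0; rewrite lee_fin mulr_ge0 ?c0. Qed.

Let pE t x y : 0 <= t -> (p t x y)%:E = \esum_(n in [set: nat]) (c t n * a n x y)%:E.
Proof.
move=> t0; rewrite fineK// ge0_fin_numE; last by apply: esum_ge0 => n _; exact: ca0.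
rewrite (@le_lt_trans _ _ 1%E) ?ltry// -(c_sum t0).
by apply: le_esum => n _; rewrite lee_fin ler_wpM2l// c0.
Qed.

Lemma unif_trans_ge0 t x y : 0 <= t -> 0 <= p t x y.
Proof. by move=> t0; rewrite -lee_fin pE//; apply: esum_ge0 => n _; exact: ca0. Qed.

Let esum_swap (T1 T2 : choiceType) (F : T1 -> T2 -> \bar R) : (forall i j, 0 <= F i j)%E ->
  (\esum_(i in [set: T1]) \esum_(j in [set: T2]) F i j =
   \esum_(j in [set: T2]) \esum_(i in [set: T1]) F i j)%E.
Proof.
move=> F0; rewrite !esum_esum//.
rewrite (reindex_esum ([set: T2] `*`` (fun=> [set: T1])) _ (fun ji => (ji.2, ji.1)))//.
by split=> [[j i]|[j i] [j' i'] _ _ /= [-> ->]|[i j] _]//; exists (j, i).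
Qed.

Lemma unif_trans_sum t x : 0 <= t -> \esum_(y in [set: S]) (p t x y)%:E = 1%E.
Proof.
move=> t0; under eq_esum do rewrite pE//.
rewrite esum_swap; last by move=> *; exact: ca0.
rewrite -(c_sum t0); apply: eq_esum => n _.
under eq_esum do rewrite EFinM.
by rewrite esumZl ?c0 ?a_sum// => y; rewrite lee_fin.
Qed.

Lemma unif_trans_0 x y : p 0 x y = (x == y)%:R.
Proof.
apply: EFin_inj; rewrite pE// -[RHS](esum_delta 0%N (g := fun n => a n x y))//.
apply: eq_esum => n _; rewrite /c mulr0 oppr0 expR0 mul1r expr0n.
by have [->|] := eqVneq n 0%N; rewrite ?mul0r// fact0 divr1.
Qed.

Let c_add s t n : c (s + t) n = \sum_(i < n.+1) c s i * c t (n - i)%N.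
Proof.
rewrite /c addrC exprDn mulr_sumr mulr_suml; apply: eq_bigr => i _.
rewrite mulrDr opprD expRD -mulr_natr -(bin_fact (_ : i <= n)%N) -1?ltnS// !natrM.
set u := i`!%:R; set v := (n - i)`!%:R; set b := 'C(n, i)%:R.
have u0 : u != 0 by rewrite pnatr_eq0 -lt0n fact_gt0.
have v0 : v != 0 by rewrite pnatr_eq0 -lt0n fact_gt0.
have b0 : b != 0 by rewrite pnatr_eq0 -lt0n bin_gt0 -ltnS.
by field; rewrite u0 v0 b0.
Qed.

(** All terms are nonnegative, so the sums over states and powers may be exchanged. Powers of [A]
    multiply by [a_comp], and a Cauchy product combines the coefficients by the binomial formula
    [c_add]. *)
Lemma unif_trans_comp s t x z : 0 <= s -> 0 <= t ->
  (p (s + t) x z)%:E = \esum_(y in [set: S]) (p s x y * p t y z)%:E.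
Proof.
move=> s0 t0; pose F y n m := (c s n * a n x y * (c t m * a m y z))%:E.
have F0 y n m : (0 <= F y n m)%E.
  by rewrite lee_fin; apply: mulr_ge0; apply: mulr_ge0; rewrite ?c0 ?a0.
have E y : ((p s x y * p t y z)%:E =
    \esum_(n in [set: nat]) \esum_(m in [set: nat]) F y n m)%E.
  rewrite mulrC EFinM (pE x y s0) -esumZl ?unif_trans_ge0//; last by move=> n; exact: ca0.
  apply: eq_esum => n _; rewrite muleC pE// -esumZl; last 2 first.
  - by apply: mulr_ge0; rewrite ?c0 ?a0.
  - by move=> m; exact: ca0.
  by apply: eq_esum => m _; rewrite -EFinM.
under eq_esum do rewrite E.
rewrite esum_swap; last by move=> y n; apply: esum_ge0.
under eq_esum => n _ do rewrite esum_swap//.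
rewrite pE ?addr_ge0//; under [RHS]eq_esum => n _.
  under eq_esum => m _.
    rewrite (_ : \esum_(y in _) _ = (c s n * c t m * a (n + m) x z)%:E); last first.
      rewrite EFinM -a_comp -esumZl; last 2 first.
      - by apply: mulr_ge0; rewrite c0.
      - by move=> y; rewrite lee_fin mulr_ge0.
      by apply: eq_esum => y _; rewrite /F -EFinM; congr EFin; ring.
    over.
  over.
rewrite esum_cauchy; last first.
  by move=> n m; rewrite lee_fin; do 2?apply: mulr_ge0; rewrite ?c0 ?a0.
apply: eq_esum => n _; rewrite sumEFin c_add mulr_suml; congr EFin.
by apply: eq_bigr => i _; rewrite subnKC// -ltnS.
Qed.

Lemma unif_trans_transition : transition_function p.
Proof.
split; [exact: unif_trans_ge0|exact: unif_trans_sum|exact: unif_trans_0|exact: unif_trans_comp].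
Qed.

(** [None] stands for a step of length [h] without points, [Some] for a step with exactly one. The
    mass of two points or more is dropped and not redistributed: the chain is substochastic, and its
    missing mass measures the error. *)
Definition euler_weight (h : R) (j : option J) (x : S) : R :=
  expR (- (L * h)) * (if j is Some j' then h * w j' x else 1).

Definition euler_move (j : option J) (x : S) : S :=
  if j is Some j' then psi j' x else x.

Definition euler_op (h : R) := kernel_op (euler_weight h) euler_move.

Lemma euler_opE h f x :
  euler_op h f x = expR (- (L * h)) * (f x + h * kernel_op w psi f x).
Proof.
rewrite /euler_op /kernel_op big_option /euler_weight /= mulr1 mulrDr.
rewrite !mulr_sumr; congr (_ + _); apply: eq_bigr => j _; ring.
Qed.

Lemma euler_weight_ge0 h : 0 <= h -> forall j x, 0 <= euler_weight h j x.
Proof. by move=> h0 [j|] x; rewrite mulr_ge0 ?expR_ge0// mulr_ge0. Qed.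

Lemma euler_weight_sum h x :
  \sum_j euler_weight h j x = expR (- (L * h)) * (1 + L * h).
Proof.
by rewrite big_option /euler_weight -mulr_sumr -mulrDr -mulr_sumr wL (mulrC h).
Qed.

(* Entrywise, the transition matrix dominates the k-th power of the Euler matrix,
   since it contains its first two terms when k = 1.  An entry of the difference is
   thus at most the difference of the row sums. *)
Lemma unif_trans_euler k h x y : 0 <= h ->
  0 <= p (h *+ k) x y - iter k (euler_op h) (fun z => (z == y)%:R) x
    <= 1 - (expR (- (L * h)) * (1 + L * h)) ^+ k.
Proof.
move=> h0; pose e m x y := iter m (euler_op h) (fun z => (z == y)%:R) x.
have e0 m x' y' : 0 <= e m x' y'.
  by apply: kernel_op_ge0 => //; exact: euler_weight_ge0.
have hk0 m : 0 <= h *+ m by rewrite mulrn_wge0.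
have e1_le x' y' : e 1 x' y' <= p h x' y'.
  rewrite -lee_fin pE//; apply: esum_ge; exists `I_2; first by split; [exact: finite_II|].
  rewrite -(@fsbig_ord _ _ _ 2 (fun n => (c h n * a n x' y')%:E)) sumEFin lee_fin.
  rewrite !big_ord_recr big_ord0 /= add0r /e /= euler_opE /c /a /=.
  by rewrite fact0 !divr1 expr0 expr1 mulr1 mulrDr mulrA.
have e_le m x' y' : e m x' y' <= p (h *+ m) x' y'.
  elim: m x' => [|m IH] x'; first by rewrite unif_trans_0.
  rewrite -lee_fin.
  have -> : (e m.+1 x' y')%:E = \esum_(z in [set: S]) (e 1 x' z * e m z y')%:E.
    by rewrite kernel_op_esum//; exact: euler_weight_ge0.
  rewrite mulrS unif_trans_comp//.
  by apply: le_esum => z _; rewrite lee_fin ler_pM.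
have e_sum : \esum_(z in [set: S]) (e k x z)%:E = ((expR (- (L * h)) * (1 + L * h)) ^+ k)%:E.
  rewrite -(kernel_op_const euler_move k x (euler_weight_sum h)) -kernel_op_esum//.
    by apply: eq_esum => z _; rewrite mulr1.
  exact: euler_weight_ge0.
rewrite subr_ge0 e_le /=; set d := (X in X <= _).
have d0 : 0 <= d by rewrite subr_ge0 e_le.
rewrite lerBrDl -lee_fin EFinD -e_sum -(unif_trans_sum x (hk0 k)).
rewrite -(esum_delta y (fun=> d0) (g := fun=> d)) -esumD; last 2 first.
- by move=> z _; rewrite lee_fin e0.
- by move=> z _; rewrite lee_fin mulr_ge0.
apply: le_esum => z _; rewrite lee_fin.
have [<-|_] := eqVneq y z; first by rewrite mul1r /d addrC subrK.
by rewrite mul0r addr0 e_le.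
Qed.

Let cvg_rate (F : R -> R) (k : R) :
  (forall h, 0 < h -> `|F h - expR (- (L * h)) * (h * k)| <= (L * h) ^+ 2) ->
  F h / h @[h --> 0^'+] --> k.
Proof.
move=> Fk.
have {}Fk h : 0 < h -> `|F h / h - expR (- (L * h)) * k| <= L ^+ 2 * h.
  move=> h0; rewrite -(ler_pM2r h0) -[X in `|_| * X](gtr0_norm h0) -normrM mulrBl divfK ?gt_eqF//.
  rewrite -mulrA (mulrC k) (_ : L ^+ 2 * h * h = (L * h) ^+ 2); last ring.
  exact: Fk.
have cvg_e : expR (- (L * h)) * k @[h --> (0 : R)^'+] --> k.
  apply: cvg_at_right_filter.
  have E : expR (- (L * 0)) * k = k by rewrite mulr0 oppr0 expR0 mul1r.
  rewrite -[X in _ --> X]E.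
  apply: cvgM; last exact: cvg_cst.
  apply: continuous_cvg; first exact: continuous_expR.
  by apply: cvgN; apply: cvgM; [exact: cvg_cst|apply: cvg_id].
have cvg_0 : L ^+ 2 * h @[h --> (0 : R)^'+] --> (0 : R).
  apply: cvg_at_right_filter; rewrite -[X in _ --> X](mulr0 (L ^+ 2)).
  by apply: cvgM; [exact: cvg_cst|apply: cvg_id].
apply: (@squeeze_cvgr _ _ _ _ (fun h => expR (- (L * h)) * k - L ^+ 2 * h)
   (fun h => expR (- (L * h)) * k + L ^+ 2 * h)).
- near=> h; have h0 : 0 < h by near: h; exact: nbhs_right_gt.
  by have := Fk h h0; rewrite ler_norml => /andP[? ?]; apply/andP; lra.
- by rewrite -[X in _ --> X]subr0; exact: cvgB.
- by rewrite -[X in _ --> X]addr0; exact: cvgD.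
Unshelve. all: by end_near. Qed.

Lemma unif_trans_rates (q : S -> S -> R) :
  (forall x y, x != y -> q x y = \sum_j w j x * (psi j x == y)%:R) ->
  has_rates p q.
Proof.
move=> qE; pose g x y := \sum_j w j x * (psi j x == y)%:R.
have bound h x y : 0 < h -> let e := expR (- (L * h)) in
  [/\ 0 <= p h x y - e * ((x == y)%:R + h * g x y),
      p h x y - e * ((x == y)%:R + h * g x y) <= 1 - e * (1 + L * h) &
      1 - e * (1 + L * h) <= (L * h) ^+ 2].
  move=> h0 e; have := unif_trans_euler 1 x y (ltW h0).
  rewrite mulr1n /= expr1 euler_opE => /andP[p0 p1]; split=> //.
  by have := one_sub_sqr_le_expRN (mulr_ge0 (ltW L_gt0) (ltW h0)); rewrite -/e; lra.
split=> [x y xy|x].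
  rewrite qE//; apply: cvg_rate => h h0.
  have [] := bound h x y h0; rewrite (negbTE xy) add0r -/(g x y) => p0 p1 p2.
  by rewrite ger0_norm// (le_trans p1).
(* The moves have total rate [L], from which those that fix [x] are subtracted. *)
have -> : \esum_(y in [set y | y != x]) (q x y)%:E = (L - g x x)%:E.
  have g0 y : 0 <= g x y by apply: sumr_ge0 => j _; rewrite mulr_ge0.
  under eq_esum => y /= yx do rewrite qE 1?eq_sym//.
  have := a_sum 1 x; rewrite expr1 (esumID [set x])//; last first.
    by move=> y _; exact: g0.
  rewrite setTI esum_set1 ?lee_fin ?a0// setTI => E.
  rewrite EFinB -E addeAC subee ?add0e//.
  by congr esum; apply/seteqP; split=> y /= /eqP.
apply: cvg_EFin; first by near=> h.
apply: (cvg_rate (F := fun h => 1 - p h x x)) => h h0.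
have [] := bound h x x h0; rewrite eqxx.
(* The error is the missing mass of one step minus the gap between [p h x x] and its Euler value,
   and that gap lies between 0 and the missing mass. *)
move: (p h x x) (g x x) (expR _) => u v e; rewrite (_ : _ - _ - _ =
  (1 - e * (1 + L * h)) - (u - e * (1 + h * v))); last ring.
move: (u - _) (1 - _) => r s r0 rs sL; rewrite ger0_norm ?subr_ge0//; lra.
Unshelve. all: by end_near. Qed.

End uniformization.

(** * Constrained Euler chains on refined grids *)

Lemma one_sub_prod_le_sum (R : realDomainType) (T : Type) (r : seq T) (F : T -> R) :
  (forall i, 0 <= F i <= 1) -> 1 - \prod_(i <- r) F i <= \sum_(i <- r) (1 - F i).
Proof.
move=> F01; have P01 s : 0 <= \prod_(i <- s) F i <= 1.
  elim: s => [|i s /andP[p0 p1]]; rewrite ?big_nil ?big_cons ?ler01 ?lexx//.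
  by have /andP[f0 f1] := F01 i; rewrite mulr_ge0// mulr_ile1.
elim: r => [|i r IH]; first by rewrite !big_nil subrr.
rewrite !big_cons; have /andP[f0 f1] := F01 i; have /andP[p0 p1] := P01 r.
by move: (\prod_(_ <- _) _) (\sum_(_ <- _) _) IH p0 p1 => u v *; nra.
Qed.

Section constrained_chains.
Variables (R : realType) (S : choiceType) (J : finType).
Variables (w : J -> S -> R) (psi : J -> S -> S) (L : R).
Hypothesis L_gt0 : 0 < L.
Hypothesis w0 : forall j x, 0 <= w j x.
Hypothesis wL : forall x, \sum_j w j x = L.
Implicit Type r : seq (R * pred S).

Local Notation euler_op := (euler_op w psi L).
Let rho h := expR (- (L * h)) * (1 + L * h).

(* The expectation of f at the last step of the Euler chain with time steps and
   constraints r, restricted to the event that all the constraints hold. *)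
Fixpoint euler_value (f : S -> R) r : S -> R :=
  if r is (h, g) :: r' then euler_op h (fun y => (g y)%:R * euler_value f r' y) else f.

Lemma euler_value_cat f r1 r2 :
  euler_value f (r1 ++ r2) = euler_value (euler_value f r2) r1.
Proof. by elim: r1 => [|[h g] r1 IH] //=; rewrite IH. Qed.

Lemma euler_value_nseq f k h r :
  euler_value f (nseq k (h, xpredT) ++ r) = iter k (euler_op h) (euler_value f r).
Proof.
elim: k => //= k ->; congr (euler_op _ _).
by apply/funext => y; rewrite mul1r.
Qed.

Lemma euler_value_free r x :
  euler_value (fun=> 1) [seq (p.1, xpredT) | p <- r] x = \prod_(p <- r) rho p.1.
Proof.
elim: r x => [|[h g] r IH] x /=; first by rewrite big_nil.
rewrite big_cons euler_opE /kernel_op.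
under [X in h * X]eq_bigr do rewrite IH mul1r.
by rewrite IH mul1r -mulr_suml wL /rho /=; ring.
Qed.

(** Only the last of the [k + 1] equal pieces of a step keeps the constraint: the grid gets finer
    while the event on the process stays the same. *)
Fixpoint refine (k : nat) r :=
  if r is (h, g) :: r' then
    nseq k (h / k.+1%:R, xpredT) ++ (h / k.+1%:R, g) :: refine k r'
  else [::].

Lemma refine_cat k r1 r2 : refine k (r1 ++ r2) = refine k r1 ++ refine k r2.
Proof. by elim: r1 => [|[h g] r1 IH] //=; rewrite IH -catA. Qed.

Lemma refine_gt0 k r : all (fun p => 0 < p.1) r -> all (fun p => 0 < p.1) (refine k r).
Proof.
elim: r => [|[h g] r IH] //= /andP[h0 /IH r0].
by rewrite all_cat all_nseq /= divr_gt0// orbT.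
Qed.

Lemma euler_value_refine1 k t y :
  euler_value (fun=> 1) (refine k [:: (t, pred1 y : pred S)]) =
  iter k.+1 (euler_op (t / k.+1%:R)) (fun z => (z == y)%:R).
Proof.
rewrite /= euler_value_nseq /= -iterS iterSr; congr iter.
by congr (euler_op _ _); apply/funext => z; rewrite mulr1.
Qed.

(** A step [h] is cut into [k + 1] steps that each miss a mass of at most [(L h / (k + 1)) ^ 2], and
    a product misses at most the sum of what its factors miss. *)
Lemma refine_defect k r : all (fun p => 0 < p.1) r ->
  0 <= 1 - \prod_(p <- refine k r) rho p.1 <= (\sum_(p <- r) (L * p.1) ^+ 2) / k.+1%:R.
Proof.
move=> r0; have L0 := ltW L_gt0.
have rho01 h : 0 <= h -> 0 <= rho h <= 1.
  move=> h0; have u0 := mulr_ge0 L0 h0; rewrite /rho mulr_ge0 ?expR_ge0 ?addr_ge0//=.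
  by rewrite expRN mulrC ler_pdivrMr ?expR_gt0// mul1r expR_ge1Dx.
(* [one_sub_prod_le_sum] asks for factors in [[0, 1]] throughout; [rho] is replaced by 1 at negative
   durations, which do not occur in the list. *)
pose F (p : R * pred S) := if 0 <= p.1 then rho p.1 else 1.
have -> : \prod_(p <- refine k r) rho p.1 = \prod_(p <- refine k r) F p.
  rewrite !big_seq; apply: eq_bigr => p /(allP (refine_gt0 k r0)) p0.
  by rewrite /F ltW.
have F01 p : 0 <= F p <= 1.
  by rewrite /F; case: ifP => [/rho01//|_]; rewrite ler01 lexx.
rewrite subr_ge0 prodr_ile1//=; apply: (le_trans (one_sub_prod_le_sum _ F01)).
elim: r r0 => [|[h g] r IH] /=; first by rewrite !big_nil mul0r.
move=> /andP[h0 /IH {}IH].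
have hk0 : 0 < h / k.+1%:R by rewrite divr_gt0.
have rhoh : 1 - rho (h / k.+1%:R) <= (L * (h / k.+1%:R)) ^+ 2.
  by rewrite lerBlDl -lerBlDr; exact: one_sub_sqr_le_expRN (mulr_ge0 L0 (ltW hk0)).
rewrite big_cat big_cons /= big_nseq iter_addr_0 big_cons mulrDl addrA lerD//.
rewrite -mulrSr /F /= (ltW hk0).
apply: (@le_trans _ _ ((L * (h / k.+1%:R)) ^+ 2 *+ k.+1)); first by rewrite lerMn2r.
have k0 : (k.+1%:R : R) != 0 by rewrite pnatr_eq0.
rewrite -mulr_natr le_eqVlt; apply/orP; left; apply/eqP; field.
by rewrite addrC natr1.
Qed.

End constrained_chains.

(** * Marked jump processes and their Markov property *)

Lemma fsbig_setT (T : Type) (idx : T) (op : Monoid.com_law idx) (K : finType) (F : K -> T) :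
  \big[op/idx]_(i \in [set: K]) F i = \big[op/idx]_i F i.
Proof.
rewrite (fsbig_seq _ F (index_enum_uniq K)); apply: eq_fsbigl.
by apply/seteqP; split=> k _ //=; rewrite mem_index_enum.
Qed.

Section finite_partitions.
Variables (d : measure_display) (Omega : measurableType d) (R : realType).
Variable P : probability Omega R.
Implicit Types (E F G : set Omega).

Definition pr E : R := fine (P E).

Lemma prE E : measurable E -> P E = (pr E)%:E.
Proof. by move=> mE; rewrite fineK// fin_num_measure. Qed.

Lemma pr_ge0 E : 0 <= pr E.
Proof. exact: fine_ge0. Qed.

Lemma pr_set0 : pr set0 = 0.
Proof. by rewrite /pr measure0. Qed.

Lemma le_pr E F : measurable E -> measurable F -> E `<=` F -> pr E <= pr F.
Proof. by move=> mE mF EF; rewrite -lee_fin -!prE// le_measure// inE. Qed.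

Lemma pr_setID E F : measurable E -> measurable F ->
  pr E = pr (E `&` F) + pr (E `\` F).
Proof.
move=> mE mF; have mI := measurableI _ _ mE mF; have mD := measurableD mE mF.
by apply: EFin_inj; rewrite EFinD -!prE// addeC; exact: measureDI.
Qed.

Variable G : set Omega.
Hypotheses (mG : measurable G) (G1 : P (~` G) = 0%E).

Lemma pr_full E : measurable E -> pr (E `&` G) = pr E.
Proof.
move=> mE; rewrite [RHS](pr_setID mE mG) /pr [P (E `\` G)](_ : _ = 0%E) ?addr0//.
apply: (subset_measure0 _ _ _ G1); [exact: measurableD|exact: measurableC|by move=> w []].
Qed.

Lemma eq_pr_full E F : measurable E -> measurable F ->
  (forall w, G w -> E w <-> F w) -> pr E = pr F.
Proof.
move=> mE mF EF; rewrite -pr_full// -(pr_full mF); congr pr.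
by apply/seteqP; split=> w [? Gw]; split=> //; apply/EF.
Qed.

(** [kappa] is a bare function witnessing that, within [E] and on the full event [G], exactly one
    [D k] holds; measurability is asked of the [D k]. *)
Lemma pr_partition (K : finType) (kappa : Omega -> K) (D : K -> set Omega) E :
  measurable E -> (forall k, measurable (D k)) ->
  (forall w k, G w -> E w -> D k w <-> kappa w = k) ->
  pr E = \sum_k pr (E `&` D k).
Proof.
move=> mE mD ED; have mED k : measurable (E `&` D k `&` G).
  by apply: measurableI => //; exact: measurableI.
rewrite -pr_full//; have -> : E `&` G = \bigcup_(k in [set: K]) (E `&` D k `&` G).
  apply/seteqP; split=> [w [Ew Gw]|w [k _ [[Ew _] Gw]]//].
  by exists (kappa w) => //; split=> //; split=> //; apply/ED.
apply: EFin_inj; rewrite -sumEFin -prE; last first.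
  by apply: fin_bigcup_measurable => [|k _]; [exact: finite_finset|].
rewrite measure_fin_bigcup//; [|exact: finite_finset|].
  rewrite fsbig_setT; apply: eq_bigr => k _; apply: (etrans (prE (mED k))).
  by rewrite pr_full//; exact: measurableI.
move=> k k' _ _ [w [[[Ew Dk] Gw] [[_ Dk'] _]]].
by rewrite -((ED _ _ Gw Ew).1 Dk) -((ED _ _ Gw Ew).1 Dk').
Qed.

End finite_partitions.

(** * Increments of the clocks and events on the marks *)

Section count_increments.
Variables (R : realType) (Omega : Type).
Implicit Types (N : R -> Omega -> nat) (s : R) (hs : seq (R * nat)).

Fixpoint increments N s hs : set Omega :=
  if hs is (h, k) :: hs' then
    [set w | N (s + h) w = (N s w + k)%N] `&` increments N (s + h) hs'
  else setT.

Lemma increments_rcons N s hs h k :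
  increments N s (rcons hs (h, k)) = increments N s hs `&`
    [set w | N (s + \sum_(p <- hs) p.1 + h) w = (N (s + \sum_(p <- hs) p.1)%R w + k)%N].
Proof.
elim: hs s => [|[h' k'] hs IH] s /=; first by rewrite big_nil addr0 setIT setTI.
by rewrite IH big_cons /= setIA !addrA.
Qed.

Lemma incrementsE N s hs w : increments N s hs w ->
  N (s + \sum_(p <- hs) p.1) w = (N s w + \sum_(p <- hs) p.2)%N.
Proof.
elim: hs s => [|[h' k'] hs IH] s /=; first by rewrite !big_nil addr0 addn0.
by move=> [Nh /IH]; rewrite !big_cons /= addrA Nh addnA.
Qed.

End count_increments.

Lemma measurable_rv2 (d : measure_display) (Omega : measurableType d)
    (T T' : countType) (V : Omega -> T) (V' : Omega -> T') (Q : T -> T' -> Prop) :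
  discrete_rv V -> discrete_rv V' -> measurable [set w | Q (V w) (V' w)].
Proof.
move=> mV mV'; pose F (xy : T * T') := if `[<Q xy.1 xy.2>]
  then V @^-1` [set xy.1] `&` V' @^-1` [set xy.2] else set0.
have -> : [set w | Q (V w) (V' w)] = \bigcup_xy F xy.
  apply/seteqP; split=> [w Qw|w [[x y] _]]; last first.
    by rewrite /F; case: asboolP => //= Qxy [-> ->].
  by exists (V w, V' w) => //; rewrite /F; case: asboolP.
apply: countable_bigcupT_measurable => // xy; rewrite /F; case: asboolP => // _.
exact: measurableI.
Qed.

Lemma measurable_rv (d : measure_display) (Omega : measurableType d)
    (T : countType) (V : Omega -> T) (Q : T -> Prop) :
  discrete_rv V -> measurable [set w | Q (V w)].
Proof. by move=> mV; exact: (measurable_rv2 (fun x _ => Q x) mV mV). Qed.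

Section poisson_increments.
Variables (d : measure_display) (Omega : measurableType d) (R : realType).
Variables (P : probability Omega R) (rate : R) (N : R -> Omega -> nat).
Hypothesis pN : poisson_process P rate N.

(** The default length 1 past the end of the list keeps the times [t] strictly increasing at all
    indices, as [poisson_indep_increments] requires of its infinite sequence. *)
Lemma increments_bigI s hs (t := fun m => s + \sum_(i < m) (nth (1, 0%N) hs i).1) :
  increments N s hs = \big[setI/setT]_(m < size hs)
    [set w | N (t m.+1) w = (N (t m) w + (nth (1%R, 0) hs m).2)%N].
Proof.
rewrite /t {t}; elim: hs s => [|[h k] hs IH] s /=; first by rewrite big_ord0.
rewrite big_ord_recl big_ord0 addr0 big_ord1 IH; congr (_ `&` _).
apply: eq_bigr => m _; apply/funext => w /=.
by rewrite ![\sum_(_ < (bump _ _).+1) _]big_ord_recl ![\sum_(_ < (bump _ _)) _]big_ord_recl /= !addrA.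
Qed.

Lemma poisson_increments_prob s hs : 0 <= s -> all (fun p => 0 < p.1) hs ->
  P (increments N s hs) = (\prod_(p <- hs) poisson_pmf (rate * p.1) p.2)%:E.
Proof.
move=> s0 /allP hs0; rewrite increments_bigI.
set t := fun m => s + \sum_(i < m) (nth (1, 0%N) hs i).1.
have nth0 m : 0 < (nth (1, 0%N) hs m).1.
  by have [mhs|/(nth_default _)->//] := ltnP m (size hs); exact/hs0/mem_nth.
have tS m : t m.+1 = t m + (nth (1, 0%N) hs m).1 by rewrite /t big_ord_recr addrA.
have t_ge0 m : 0 <= t m by rewrite addr_ge0// sumr_ge0// => i _; exact: ltW.
have -> := poisson_indep_increments pN (size hs) (t := t)
   (fun m => (nth (1, 0%N) hs m).2) (t_ge0 0%N).
  rewrite -prodEFin (big_nth (1, 0%N)) big_mkord; apply: eq_bigr => m _.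
  by rewrite (poisson_increment_law pN)//; rewrite tS ?ltrDl// addrC addKr.
by move=> m; rewrite tS ltrDl.
Qed.

Lemma measurable_increments s hs : 0 <= s -> all (fun p => 0 < p.1) hs ->
  measurable (increments N s hs).
Proof.
elim: hs s => //= -[h k] hs IH s s0 /= /andP[h0 hs0].
have sh0 : 0 <= s + h by rewrite addr_ge0// ltW.
apply: measurableI; last exact: IH.
exact: (measurable_rv2 (fun a b => a = (b + k)%N) (poisson_rv pN sh0) (poisson_rv pN s0)).
Qed.

End poisson_increments.

Section marks.
Variables (Omega : Type) (S K : Type) (V : nat -> S -> Omega -> K).

Fixpoint marks_event (n : nat) (e : seq (S * K)) : set Omega :=
  if e is (x, v) :: e' then [set w | V n x w = v] `&` marks_event n.+1 e' else setT.

Lemma marks_event_cat n e e' :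
  marks_event n (e ++ e') = marks_event n e `&` marks_event (n + size e) e'.
Proof.
elim: e n => [|[x v] e IH] n /=; first by rewrite setTI addn0.
by rewrite IH setIA addSnnS.
Qed.

End marks.

(** * Grid trajectories of a marked jump process *)

Section jump_process.
Variables (R : realType) (S : countType) (B K : finType).
Variables (d : measure_display) (Omega : measurableType d) (P : probability Omega R).
Variables (l : B -> R) (N : B -> R -> Omega -> nat) (V : B -> nat -> S -> Omega -> K).
Variables (q : B -> S -> K -> R) (phi : B -> S -> K -> S) (X : R -> Omega -> S).

(* At a point of the clock N b preceded by n points, the mark V b n x, of law
   q b x, moves the state from x to phi b x (V b n x).  In jump_indep, hk b lists
   the lengths of successive time intervals from 0 and their numbers of points, and
   e b lists states and marks for the first points of N b. *)
Record marked_jump_process : Prop := MarkedJumpProcess {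
  jump_rate_gt0 : forall b, 0 < l b ;
  jump_clock : forall b, poisson_process P (l b) (N b) ;
  jump_mark_rv : forall b n x, discrete_rv (V b n x) ;
  jump_mark_ge0 : forall b x v, 0 <= q b x v ;
  jump_mark_sum : forall b x, \sum_v q b x v = 1 ;
  jump_rv : forall t, 0 <= t -> discrete_rv (X t) ;
  jump_path : \forall w \ae P, driven_path (fun b => N b ^~ w)
    (fun b n x => phi b x (V b n x w)) (X ^~ w) ;
  jump_indep : forall x0 (hk : B -> seq (R * nat)) (e : B -> seq (S * K)),
    (forall b, all (fun p => 0 < p.1) (hk b)) ->
    pr P ([set w | X 0 w = x0] `&`
      \bigcap_b (increments (N b) 0 (hk b) `&` marks_event (V b) 0 (e b)))
    = pr P [set w | X 0 w = x0] *
      \prod_b ((\prod_(p <- hk b) poisson_pmf (l b * p.1) p.2) *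
               \prod_(p <- e b) q b p.1 p.2) }.

Hypothesis jX : marked_jump_process.
Variable x0 : S.

Let L := \sum_b l b.

Definition jump_weight (bv : B * K) (x : S) : R := l bv.1 * q bv.1 x bv.2.
Definition jump_move (bv : B * K) (x : S) : S := phi bv.1 x bv.2.

(* What happens during an interval with at most one point: nothing, or a point of
   a clock, with the state before it and the mark. *)
Let letter : Type := option (B * (S * K)).

Let letter_count b (a : letter) : nat := if a is Some (b', _) then b' == b else 0%N.

Let letter_mark b (a : letter) : seq (S * K) :=
  if a is Some (b', p) then if b' == b then [:: p] else [::] else [::].

Let counts b (past : seq (R * letter)) := [seq (p.1, letter_count b p.2) | p <- past].

Let marks b (past : seq (R * letter)) := flatten [seq letter_mark b p.2 | p <- past].

Let duration (past : seq (R * letter)) := \sum_(p <- past) p.1.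

(** Beyond the initial state, only clocks and marks are prescribed, so that [jump_indep] gives the
    probability exactly. When the letters carry the states actually visited, the values of [X] on
    the grid follow on the full event by [history_step]. *)
Let history past : set Omega := [set w | X 0 w = x0] `&`
  \bigcap_b (increments (N b) 0 (counts b past) `&` marks_event (V b) 0 (marks b past)).

(** [size (marks b past)] is the number of points of the clock [b] in the past, hence the index of
    its next mark. *)
Let step_event past h (a : letter) : set Omega :=
  \bigcap_b ([set w | N b (duration past + h) w = (N b (duration past) w + letter_count b a)%N]
    `&` marks_event (V b) (size (marks b past)) (letter_mark b a)).

Let history_rcons past h a :
  history (rcons past (h, a)) = history past `&` step_event past h a.
Proof.
rewrite /history /step_event -setIA -bigcapI; congr (_ `&` _).
apply: eq_bigcapr => b _; rewrite /counts /marks !map_rcons flatten_rcons marks_event_cat /=.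
rewrite increments_rcons !big_map /= add0r add0n -/(duration past).
by rewrite !setIA; congr (_ `&` _); rewrite -!setIA; congr (_ `&` _); rewrite setIC.
Qed.

Let size_marks b past : size (marks b past) = (\sum_(p <- past) letter_count b p.2)%N.
Proof.
rewrite /marks size_flatten /shape -map_comp sumnE big_map; apply: eq_bigr => -[h [[b' p]|]] //= _.
by case: ifP => _; rewrite //=.
Qed.

Let letter_weight h a : R :=
  \prod_b (poisson_pmf (l b * h) (letter_count b a) *
           \prod_(p <- letter_mark b a) q b p.1 p.2).

Let pr_history past : all (fun p => 0 < p.1) past ->
  pr P (history past) = pr P [set w | X 0 w = x0] * \prod_(p <- past) letter_weight p.1 p.2.
Proof.
move=> past0; rewrite (jump_indep jX); last by move=> b; rewrite all_map.
congr (_ * _); rewrite exchange_big; apply: eq_bigr => b _.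
by rewrite big_map big_flatten big_map big_split.
Qed.

Let l_gt0 b : 0 < l b. Proof. exact: jump_rate_gt0. Qed.

Let prod_exp h : \prod_b expR (- (l b * h)) = expR (- (L * h)).
Proof. by rewrite -expR_sum sumrN -mulr_suml. Qed.

(** The factors for no point of each clock multiply to an exponential of the total rate; a point of
    the clock [b] contributes a further [l b * h], and its mark the probability [q b x v]. *)
Let letter_weightE h j x : 0 < h ->
  letter_weight h (omap (fun bv => (bv.1, (x, bv.2))) j) = euler_weight jump_weight L h j x.
Proof.
move=> h0; rewrite /euler_weight -prod_exp; case: j => [[b v]|] /=.
  rewrite /letter_weight (bigD1 b)//= [in RHS](bigD1 b)//= eqxx big_seq1 /=.
  rewrite (eq_bigr (fun b => expR (- (l b * h)))); last first.
    move=> b' /negbTE b'b; rewrite eq_sym b'b big_nil mulr1 /poisson_pmf mulr_gt0//.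
    by rewrite expr0 fact0 divr1 mul1r.
  rewrite /poisson_pmf mulr_gt0// /jump_weight expr1 divr1 /=; ring.
rewrite mulr1; apply: eq_bigr => b _; rewrite big_nil mulr1 /poisson_pmf mulr_gt0//.
by rewrite expr0 fact0 divr1 mul1r.
Qed.

Let total t w := (\sum_b N b t w)%N.

Fixpoint future (T : R) (r : seq (R * pred S)) : set Omega :=
  if r is (h, g) :: r' then [set w | g (X (T + h) w)] `&` future (T + h) r' else setT.

Fixpoint sparse (T : R) (r : seq (R * pred S)) : set Omega :=
  if r is (h, g) :: r' then
    [set w | (\sum_b N b (T + h)%R w <= (\sum_b N b T w).+1)%N] `&` sparse (T + h) r'
  else setT.

Let measurable_X t (Q : S -> Prop) : 0 <= t -> measurable [set w | Q (X t w)].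
Proof. by move=> t0; exact: (measurable_rv Q (jump_rv jX t0)). Qed.

Let measurable_marks b n e : measurable (marks_event (V b) n e).
Proof.
elim: e n => //= -[x v] e IH n; apply: measurableI => //.
exact: (jump_mark_rv jX).
Qed.

Let measurable_history past : all (fun p => 0 < p.1) past -> measurable (history past).
Proof.
move=> past0; apply: measurableI; first exact: (measurable_X (fun y => y = x0)).
apply: fin_bigcap_measurable => [|b _]; first by apply: finite_finset.
apply: measurableI.
  by apply: (measurable_increments (jump_clock jX b)) => //; rewrite all_map.
exact: measurable_marks.
Qed.

Let measurable_step past h a : 0 <= duration past -> 0 < h ->
  measurable (step_event past h a).
Proof.
move=> T0 h0; apply: fin_bigcap_measurable => [|b _]; first by apply: finite_finset.
apply: measurableI; last exact: measurable_marks.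
have Th0 : 0 <= duration past + h by rewrite addr_ge0// ltW.
by apply: (measurable_rv2 (fun u v => u = (v + letter_count b a)%N));
  apply: (poisson_rv (jump_clock jX b)).
Qed.

Let measurable_total s t (Q : nat -> nat -> Prop) : 0 <= s -> 0 <= t ->
  measurable [set w | Q (total s w) (total t w)].
Proof.
move=> s0 t0; pose Nf u w := [ffun b => N b u w] : {ffun B -> nat}.
have mNf u : 0 <= u -> discrete_rv (Nf u).
  move=> u0 f; rewrite (_ : _ @^-1` _ = \bigcap_b [set w | N b u w = f b]).
    apply: fin_bigcap_measurable => [|b _]; first by apply: finite_finset.
    exact: (poisson_rv (jump_clock jX b)).
  apply/seteqP; split=> w /= => [<- b _|Nfb]; first by rewrite ffunE.
  by apply/ffunP => b; rewrite ffunE Nfb.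
have E u w : total u w = (\sum_b Nf u w b)%N by apply: eq_bigr => b _; rewrite ffunE.
have := measurable_rv2 (fun f g : {ffun B -> nat} => Q (\sum_b f b)%N (\sum_b g b)%N) (mNf s s0) (mNf t t0).
by congr measurable; apply/seteqP; split=> w /=; rewrite !E.
Qed.

Lemma measurable_future T r : 0 <= T -> all (fun p => 0 < p.1) r -> measurable (future T r).
Proof.
elim: r T => //= -[h g] r IH T T0 /= /andP[h0 r0].
have Th0 : 0 <= T + h by rewrite addr_ge0// ltW.
by apply: measurableI; [exact: (measurable_X g)|exact: IH].
Qed.

Lemma measurable_sparse T r : 0 <= T -> all (fun p => 0 < p.1) r -> measurable (sparse T r).
Proof.
elim: r T => //= -[h g] r IH T T0 /= /andP[h0 r0].
have Th0 : 0 <= T + h by rewrite addr_ge0// ltW.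
apply: measurableI; last exact: IH.
exact: (measurable_total (fun a b => (a <= b.+1)%N)).
Qed.

Lemma total_rate_gt0 (b : B) : 0 < \sum_b l b.
Proof. by rewrite (bigD1 b)//= ltr_pwDl// sumr_ge0// => b' _; exact: ltW. Qed.

Lemma jump_weight_ge0 j x : 0 <= jump_weight j x.
Proof. by rewrite mulr_ge0 ?(jump_mark_ge0 jX)// ltW. Qed.

Lemma jump_weight_sum x : \sum_j jump_weight j x = \sum_b l b.
Proof.
rewrite -(pair_bigA _ (fun b v => jump_weight (b, v) x)); apply: eq_bigr => b _ /=.
by rewrite /jump_weight /= -mulr_sumr (jump_mark_sum jX) mulr1.
Qed.

Section full_event.
Variable G : set Omega.
Hypotheses (mG : measurable G) (G1 : P (~` G) = 0%E).
Hypothesis G_path : forall w, G w -> driven_path (fun b => N b ^~ w)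
    (fun b n x => phi b x (V b n x w)) (X ^~ w).

Let duration_ge0 past : all (fun p => 0 < p.1) past -> 0 <= duration past.
Proof.
by move=> /allP past0; rewrite /duration big_seq sumr_ge0// => p /past0/ltW.
Qed.

Let history_count past w b : G w -> history past w ->
  N b (duration past) w = size (marks b past).
Proof.
move=> Gw [_ /(_ b I)[iw _]]; have := incrementsE iw.
rewrite add0r !big_map /= => ->; rewrite -size_marks.
by have [-> _ _ _] := driven_counting (G_path Gw) b.
Qed.

Let history_step past h x w j : G w -> history past w -> X (duration past) w = x ->
  0 <= duration past -> 0 < h ->
  step_event past h (omap (fun bv => (bv.1, (x, bv.2))) j) w ->
  X (duration past + h) w = euler_move jump_move j x.
Proof.
move=> Gw hw Xw T0 h0 sw; have dw := G_path Gw.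
have Th : duration past <= duration past + h by rewrite lerDl ltW.
case: j sw => [[b v]|] sw /=; last first.
  rewrite -(driven_constant dw T0 Th)// => b.
  by have [/= ->] := sw b I; rewrite addn0.
rewrite (single_jump dw T0 Th (b := b)); last 2 first.
- by have [/= ->] := sw b I; rewrite eqxx addn1.
- by move=> b' b'b; have [/= ->] := sw b' I; rewrite eq_sym (negbTE b'b) addn0.
rewrite Xw /jump_move /= history_count//.
by have [_ /=] := sw b I; rewrite eqxx /= => -[-> _].
Qed.

Let last_step past h x w : option (B * K) :=
  if [pick b | N b (duration past + h) w != N b (duration past) w] is Some b
  then Some (b, V b (N b (duration past) w) x w) else None.

Let last_stepP past h x w j : G w -> history past w -> 0 <= duration past -> 0 < h ->
  (total (duration past + h) w <= (total (duration past) w).+1)%N ->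
  step_event past h (omap (fun bv => (bv.1, (x, bv.2))) j) w <-> last_step past h x w = j.
Proof.
move=> Gw hw T0 h0 tot; have dw := G_path Gw.
have Nle b : (N b (duration past) w <= N b (duration past + h) w)%N.
  by apply: (counting_mono (driven_counting dw b)) => //; rewrite lerDl ltW.
rewrite /last_step; split=> [sw|].
  have Nw b : N b (duration past + h) w = (N b (duration past) w +
      letter_count b (omap (fun bv => (bv.1, (x, bv.2))) j))%N by have [] := sw b I.
  case: pickP => [b|Neq].
    rewrite Nw -[X in _ != X]addn0 eqn_add2l; case: j sw {Nw} => //= -[b' v] sw /=.
    case: (eqVneq b' b) => // b'b; rewrite {}b'b {b'} in sw *.
    by have [_ /=] := sw b I; rewrite eqxx /= history_count// => -[-> _].
  case: j sw Nw => //= -[b v] _ /(_ b); have /negbFE/eqP -> := Neq b.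
  by rewrite eqxx; lia.
case: pickP => [b Nb|Neq] <- b' _ /=; last first.
  by split=> //; rewrite addn0; have /negbFE/eqP := Neq b'.
have NbS : (N b (duration past) w < N b (duration past + h) w)%N.
  by rewrite ltn_neqAle eq_sym Nb Nle.
have rest : (\sum_(i | i != b) N i (duration past) w <=
             \sum_(i | i != b) N i (duration past + h) w)%N by exact: leq_sum.
move: tot; rewrite /total (bigD1 b)//= [X in (_ <= X.+1)%N](bigD1 b)//= => tot.
have [<-|b'b] := eqVneq b b' => /=.
  by split; [lia|split=> //; rewrite -(history_count b Gw hw)].
split=> //; rewrite addn0.
have rest' : (\sum_(i | (i != b) && (i != b')) N i (duration past) w <=
    \sum_(i | (i != b) && (i != b')) N i (duration past + h) w)%N by exact: leq_sum.
have := Nle b'; rewrite (bigD1 b')/= in tot; last by rewrite eq_sym.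
by rewrite [X in (_ <= (_ + X).+1)%N](bigD1 b')/= in tot; [lia|rewrite eq_sym].
Qed.

Let sparse_step past h a w : step_event past h a w ->
  (total (duration past + h) w <= (total (duration past) w).+1)%N.
Proof.
move=> sw; rewrite /total (eq_bigr (fun b => N b (duration past) w + letter_count b a)%N).
  rewrite big_split /= -addn1 leq_add2l; case: a {sw} => [[b p]|] /=; last by rewrite big1.
  by rewrite (bigD1 b)//= eqxx big1 ?addn0// => b' /negbTE; rewrite eq_sym => ->.
by move=> b _; have [] := sw b I.
Qed.

(* A history determines the present state and the numbers of points of the clocks,
   hence the next mark to be used, and each letter extends it to a history whose
   probability is multiplied by the weight of the letter. *)
Lemma history_future r past x :
  all (fun p => 0 < p.1) past -> all (fun p => 0 < p.1) r ->
  (forall w, G w -> history past w -> X (duration past) w = x) ->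
  pr P (history past `&` (future (duration past) r `&` sparse (duration past) r)) =
  pr P (history past) * euler_value jump_weight jump_move L (fun=> 1) r x.
Proof.
elim: r past x => [|[h g] r IH] past x past0.
  by rewrite /= !setIT mulr1.
move=> /= /andP[h0 r0] Xpast.
have T0 := duration_ge0 past0; have Th0 : 0 <= duration past + h by rewrite addr_ge0// ltW.
pose step j : letter := omap (fun bv => (bv.1, (x, bv.2))) j.
have all_rcons a : all (fun p : R * letter => 0 < p.1) (rcons past (h, a)).
  by rewrite all_rcons h0.
have duration_rcons a : duration (rcons past (h, a)) = duration past + h.
  by rewrite /duration -cats1 big_cat big_seq1.
have mstep j : measurable (step_event past h (step j)) by exact: measurable_step.
set F := (X in pr P (_ `&` X)).
have mF : measurable F.
  apply: measurableI.
    by apply: measurableI; [exact: (measurable_X g)|exact: measurable_future].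
  apply: measurableI; last exact: measurable_sparse.
  exact: (measurable_total (fun a b => (a <= b.+1)%N)).
have mH := measurable_history past0.
rewrite (@pr_partition _ _ _ P G mG G1 _ (last_step past h x)
  (fun j => step_event past h (step j)))//; last first.
- move=> w j Gw [hw [_ [tot _]]]; apply: last_stepP => //; exact: Xpast.
- exact: measurableI.
rewrite /euler_op /kernel_op mulr_sumr; apply: eq_bigr => j _.
have X' w : G w -> history (rcons past (h, step j)) w ->
    X (duration (rcons past (h, step j))) w = euler_move jump_move j x.
  rewrite history_rcons duration_rcons => Gw [hw sw].
  by apply: history_step sw => //; exact: Xpast.
(* The extended history fixes the new state, so that the constraint [g] becomes a constant factor 0
   or 1, and sparsity of the first interval is automatic. *)
have -> : pr P (history past `&` F `&` step_event past h (step j)) =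
    (g (euler_move jump_move j x))%:R * pr P (history (rcons past (h, step j)) `&`
     (future (duration past + h) r `&` sparse (duration past + h) r)).
  have mj : measurable (history past `&` F `&` step_event past h (step j)).
    by apply: measurableI => //; exact: measurableI.
  have D w : G w -> (history past `&` F `&` step_event past h (step j)) w <->
      g (euler_move jump_move j x) /\ (history (rcons past (h, step j)) `&`
      (future (duration past + h) r `&` sparse (duration past + h) r)) w.
    move=> Gw; split=> [[[hw [[gw fw] [_ spw]]] sw]|[gw [hw' [fw spw]]]].
      have hw' : history (rcons past (h, step j)) w by rewrite history_rcons.
      by have := X' w Gw hw'; rewrite duration_rcons => <-.
    have := X' w Gw hw'; rewrite duration_rcons => Xw.
    move: (hw'); rewrite history_rcons => -[hw sw]; split=> //; split=> //.
    split; split=> //=; first by rewrite Xw.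
    exact: sparse_step sw.
  case: (g _) D => D; rewrite ?mul1r ?mul0r.
    apply: (eq_pr_full mG G1) => // [|w Gw]; last by rewrite D//; split=> [[]|].
    apply: measurableI; first exact: measurable_history.
    by apply: measurableI; [exact: measurable_future|exact: measurable_sparse].
  rewrite -(pr_set0 P); apply: (eq_pr_full mG G1) => // w Gw.
  by split=> // /(D w Gw)[].
have := IH _ _ (all_rcons (step j)) r0 X'; rewrite duration_rcons => ->.
rewrite !(pr_history) ?all_rcons//= -cats1 big_cat big_seq1 /= letter_weightE//.
ring.
Qed.

Let start : set Omega := [set w | X 0 w = x0].

Lemma start_future r : all (fun p => 0 < p.1) r ->
  pr P (start `&` (future 0 r `&` sparse 0 r)) =
  pr P start * euler_value jump_weight jump_move L (fun=> 1) r x0.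
Proof.
move=> r0; have history_nil : history [::] = start.
  rewrite /history (_ : bigcap _ _ = setT) ?setIT//.
  by apply/seteqP; split=> // w _ b _.
have := @history_future r [::] x0 isT r0.
by rewrite history_nil /duration big_nil; apply=> w _.
Qed.

End full_event.

End jump_process.

(** * Passage to the limit of fine grids *)

Lemma eq_of_dist_le_harmonic (R : realType) (x y C : R) :
  (forall k, `|x - y| <= C / k.+1%:R) -> x = y.
Proof.
move=> xyC; apply/eqP; rewrite -subr_eq0 -normr_eq0; apply: contraT => nz.
have d0 : 0 < `|x - y| by rewrite lt0r nz normr_ge0.
have C0 : 0 <= C by have := le_trans (normr_ge0 _) (xyC 0%N); rewrite divr1.
have := archi_boundP (divr_ge0 C0 (ltW d0)); set n := Num.bound _ => Cn.
have := xyC n; rewrite ler_pdivlMr// => H.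
have : C < `|x - y| * n%:R by rewrite mulrC -ltr_pdivrMr.
rewrite ltNge => /negP[]; apply: le_trans H.
by rewrite ler_pM2l// ler_nat.
Qed.

Section markov_property.
Variables (R : realType) (S : countType) (B K : finType).
Variables (d : measure_display) (Omega : measurableType d) (P : probability Omega R).
Variables (l : B -> R) (N : B -> R -> Omega -> nat) (V : B -> nat -> S -> Omega -> K).
Variables (q : B -> S -> K -> R) (phi : B -> S -> K -> S) (X : R -> Omega -> S).
Hypothesis jX : marked_jump_process P l N V q phi X.
Variable b0 : B.

Let L := \sum_b l b.
Let w := jump_weight l q.
Let psi := jump_move phi.

Let L_gt0 : 0 < L. Proof. exact: total_rate_gt0 jX b0. Qed.
Let w0 j x : 0 <= w j x. Proof. exact: jump_weight_ge0 jX j x. Qed.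
Let wL x : \sum_j w j x = L. Proof. exact: jump_weight_sum jX x. Qed.

Local Notation value := (euler_value w psi L).
Local Notation refine := (refine (S:=S)).

Lemma future_rcons T r h (g : pred S) : future X T (rcons r (h, g)) =
  future X T r `&` [set w | g (X (T + \sum_(p <- r) p.1 + h) w)].
Proof.
elim: r T => [|[h' g'] r IH] T /=; first by rewrite big_nil addr0 setIC.
by rewrite IH big_cons setIA addrA.
Qed.

Let future_nseq T h k r : future X T (nseq k (h, xpredT) ++ r) = future X (T + h *+ k) r.
Proof.
elim: k T => [|k IH] T /=; first by rewrite addr0.
by rewrite IH mulrS addrA (_ : [set w | _] = setT) ?setTI//; apply/seteqP.
Qed.

Let future_refine T r k : future X T (refine k r) = future X T r.
Proof.
elim: r T => [|[h g] r IH] T //=; rewrite future_nseq /= IH -addrA -mulrSr.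
by rewrite -(mulr_natr (h / _)) divfK ?pnatr_eq0.
Qed.

Variable x0 : S.
Let start := [set w | X 0 w = x0].

Let mstart : measurable start. Proof. exact: (jump_rv jX). Qed.

(** The grid formula computes the part of the future inside the sparse event. The rest lies in the
    start without sparsity, whose probability comes from the same formula with trivial constraints
    and is at most the missing mass bounded by [refine_defect]. *)
Lemma future_approx r k : all (fun p => 0 < p.1) r ->
  exists2 v, 0 <= v <= 1 &
    v = pr P start * value (fun=> 1) (refine k r) x0 /\
    `|pr P (start `&` future X 0 r) - v| <= (\sum_(p <- r) (L * p.1) ^+ 2) / k.+1%:R.
Proof.
move=> r0; have rk0 := refine_gt0 k r0.
have [Z [mZ Z0 ZP]] := jump_path jX.
have G_path o : (~` Z) o -> driven_path (fun b => N b ^~ o)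
    (fun b n x => phi b x (V b n x o)) (X ^~ o).
  by move=> nZ; apply: contrapT => /ZP.
have mG := measurableC mZ; have G1 : P (~` ~` Z) = 0%E by rewrite setCK.
have sf := start_future jX x0 mG G1 G_path.
have E := sf _ rk0.
set f := refine k r in rk0 E *.
have le1 A : measurable A -> pr P A <= 1.
  by move=> mA; rewrite -lee_fin -prE// probability_le1.
have mF := measurable_future jX (lexx 0) rk0; have mS := measurable_sparse jX (lexx 0) rk0.
have mSF := measurableI _ _ mstart mF.
exists (pr P (start `&` (future X 0 f `&` sparse N 0 f))).
  by rewrite pr_ge0 le1//; apply: measurableI => //; exact: measurableI.
split=> //.
have free s T : sparse N T [seq (p.1, (xpredT : pred S)) | p <- s] = sparse N T s.
  by elim: s T => //= -[h g] s IH T /=; rewrite IH.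
have freeF s T : future X T [seq (p.1, (xpredT : pred S)) | p <- s] = setT.
  elim: s T => //= -[h g] s IH T /=; rewrite IH setIT; exact/seteqP.
have := sf [seq (p.1, (xpredT : pred S)) | p <- f]; rewrite all_map => /(_ rk0).
rewrite free freeF setTI euler_value_free// => ES.
rewrite -(future_refine 0 r k) -/f (pr_setID P mSF mS) setIA addrAC subrr add0r.
rewrite ger0_norm ?pr_ge0//.
apply: (@le_trans _ _ (pr P (start `\` sparse N 0 f))).
  apply: le_pr; [exact: measurableD|exact: measurableD|by move=> v [[? ?] ?]; split].
have -> : pr P (start `\` sparse N 0 f) =
    pr P start * (1 - \prod_(p <- f) (expR (- (L * p.1)) * (1 + L * p.1))).
  by rewrite mulrBr mulr1 -ES (pr_setID P mstart mS) addrAC subrr add0r.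
have /andP[defect0 defect1] := refine_defect L_gt0 k r0.
by apply: le_trans defect1; rewrite -[leRHS]mul1r ler_wpM2r ?le1.
Qed.

(** The hypothesis on [f] expresses that the constraints force the state [x] at the last time. On
    every refined grid the final transition then factors out: the approximation of the left-hand
    side is exactly that of the past times the Euler transition from [x] to [y]. *)
Lemma markov_future r x t y : all (fun p => 0 < p.1) r -> 0 < t ->
  (forall k f, value f (refine k r) x0 = f x * value (fun=> 1) (refine k r) x0) ->
  pr P (start `&` future X 0 (rcons r (t, pred1 y : pred S))) =
  pr P (start `&` future X 0 r) * unif_trans w psi L t x y.
Proof.
move=> r0 t0 pinned; set p := unif_trans _ _ _ _ _ _.
set a := pr P _; set b := pr P _; pose C := \sum_(p <- r) (L * p.1) ^+ 2.
have p0 : 0 <= p by apply: unif_trans_ge0 => //; exact: ltW.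
(* The first two terms bound the error on [a], the third the one made on [p] by the Euler chain, and
   [C * p] the error on [b] multiplied by [p]. *)
apply: (@eq_of_dist_le_harmonic _ _ _ (C + (L * t) ^+ 2 + (L * t) ^+ 2 + C * p)) => k.
have [v /andP[v0 v1] [vE bv]] := future_approx k r0.
have rt0 : all (fun p : R * pred S => 0 < p.1) (rcons r (t, pred1 y : pred S)).
  by rewrite all_rcons /= t0.
have [u _ [uE]] := future_approx k rt0.
rewrite -/a -/b in bv *; rewrite -cats1 big_cat big_seq1 -/C /= => au.
have h0 : 0 <= t / k.+1%:R by rewrite divr_ge0// ltW.
have := unif_trans_euler psi L_gt0 w0 wL k.+1 x y h0.
rewrite -[in unif_trans _ _ _ _ _ _](mulr_natr (t / _)) divfK ?pnatr_eq0// -/p.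
set e := iter _ _ _ _ => /andP[e0 e1].
have e2 : p - e <= (L * t) ^+ 2 / k.+1%:R.
  apply: le_trans e1 _.
  have t0' : all (fun p : R * pred S => 0 < p.1) [:: (t, pred1 y : pred S)] by rewrite /= t0.
  have /andP[_] := refine_defect L_gt0 k t0'.
  by rewrite big_seq1 /= big_cat big_seq1 big_nseq iter_mulr_1 /= -exprSr.
have uve : u = v * e.
  rewrite uE vE -cats1 refine_cat euler_value_cat pinned euler_value_refine1.
  by rewrite -/e -mulrA (mulrC e).
rewrite !mulrDl (mulrAC C p).
rewrite uve in au.
have -> : a - b * p = (a - v * e) - v * (p - e) - (b - v) * p by ring.
apply: (le_trans (ler_normB _ _)); rewrite lerD//; last first.
  by rewrite normrM (ger0_norm p0) ler_wpM2r.
apply: (le_trans (ler_normB _ _)); rewrite lerD//; first by rewrite -mulrDl.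
rewrite normrM (ger0_norm v0) (ger0_norm e0); apply: le_trans e2.
by rewrite -[leRHS]mul1r ler_wpM2r.
Qed.

End markov_property.

(** * From cylinder events to the natural filtration *)

Section gaps.
Variables (R : realType) (S : countType).
Implicit Types (T : R) (us : seq R) (g : R -> pred S).

Fixpoint gaps g T us : seq (R * pred S) :=
  if us is u :: us' then (u - T, g u) :: gaps g u us' else [::].

Lemma gaps_gt0 g T us : path <%R T us -> all (fun p => 0 < p.1) (gaps g T us).
Proof. by elim: us T => //= u us IH T /andP[Tu /IH ->]; rewrite subr_gt0 Tu. Qed.

Lemma sum_gaps g T us : \sum_(p <- gaps g T us) p.1 = last T us - T.
Proof.
elim: us T => [|u us IH] T /=; first by rewrite big_nil subrr.
by rewrite big_cons IH /= addrC subrKA.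
Qed.

Lemma future_gaps (d : measure_display) (Omega : measurableType d)
    (X : R -> Omega -> S) g T us :
  future X T (gaps g T us) = [set o | all (fun u => g u (X u o)) us].
Proof.
elim: us T => [|u us IH] T /=; first by apply/seteqP.
rewrite (_ : T + (u - T) = u) ?IH; last by rewrite addrC subrK.
apply/seteqP; split=> o /=; first by case=> -> ->.
by move/andP.
Qed.

(** The constraint at the last time [s] admits no state but [x], so [f] counts only through its
    value there. With no times left, [s] is [T] and the starting point [y] itself is pinned. *)
Lemma euler_value_gaps (J : finType) (w : J -> S -> R) psi L g T us k f s x y :
  g T y -> last T us = s -> (forall z, g s z -> z = x) ->
  euler_value w psi L f (refine k (gaps g T us)) y =
  f x * euler_value w psi L (fun=> 1) (refine k (gaps g T us)) y.
Proof.
move=> + + gs; elim: us T y => [|u us IH] T y /= gy.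
  by move=> Ts; rewrite mulr1 (gs y)// -Ts.
move=> us_s; rewrite !euler_value_nseq /= -!iterSr -kernel_opZ /euler_op.
congr (iter _ _ _ _); apply/funext => z.
by case: (boolP (g u z)) => [gz|_]; rewrite ?mul1r ?mul0r ?mulr0// (IH u).
Qed.

End gaps.

Lemma path_le_last (R : realDomainType) (T : R) us u :
  path <%R T us -> u \in T :: us -> u <= last T us.
Proof.
elim: us T u => [|v us IH] T u /=; first by rewrite inE => _ /eqP->.
move=> /andP[Tv pus]; rewrite in_cons => /predU1P[->|]; last exact: IH.
by apply: le_trans (ltW Tv) _; apply: IH => //; rewrite mem_head.
Qed.

Section scaled_measures.
Variables (d : measure_display) (Omega : measurableType d) (R : realType).
Variables (P : probability Omega R) (p : R) (C D : set Omega).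
Hypotheses (mC : measurable C) (mD : measurable D).

Lemma measure_bigcup_scale (F : nat -> set Omega) : (forall n, measurable (F n)) ->
  trivIset [set: nat] F ->
  (forall n, P (F n `&` D) = P (F n `&` C) * p%:E)%E ->
  (P (\bigcup_n F n `&` D) = P (\bigcup_n F n `&` C) * p%:E)%E.
Proof.
move=> mF tF FE; rewrite ![(\bigcup_n F n) `&` _]setIC !setI_bigcupr.
have triv E : trivIset [set: nat] (fun n => E `&` F n) by exact: trivIset_setIl.
rewrite !measure_bigcup//; try by move=> n _; exact: measurableI.
rewrite muleC -nneseriesZl//; apply: eq_eseriesr => n _.
by have := FE n; rewrite (setIC D) (setIC C) muleC.
Qed.

(** The identity is stable under countable disjoint unions, and under complements by subtraction
    from its instance for the whole space, which [M] contains. It thus holds on a Dynkin system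
    containing a class stable under intersections. *)
Lemma dynkin_scale (M : set (set Omega)) :
  setI_closed M -> M [set: Omega] -> M `<=` measurable ->
  (forall E, M E -> P (E `&` D) = P (E `&` C) * p%:E)%E ->
  forall E, <<s M >> E -> (P (E `&` D) = P (E `&` C) * p%:E)%E.
Proof.
move=> MI MT mM ME E sE.
suff: measurable E /\ (P (E `&` D) = P (E `&` C) * p%:E)%E by case.
apply: (@dynkin_induction _ (g_sigma_algebraType M) M (fun E => measurable (E : set Omega) /\
  (P (E `&` D) = P (E `&` C) * p%:E)%E)) sE => //.
- by split; [exact: measurableT|exact: ME].
- by move=> F MF; split; [exact: mM|exact: ME].
- move=> F _ [mF FE]; split; first exact: measurableC.
  have PT : (P D = P C * p%:E)%E by have := ME _ MT; rewrite !setTI.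
  have mFC := measurableI _ _ mF mC; have mFD := measurableI _ _ mF mD.
  have mFC' := measurableI _ _ (measurableC mF) mC; have mFD' := measurableI _ _ (measurableC mF) mD.
  have split_pr A : measurable A -> pr P A = pr P (F `&` A) + pr P (~` F `&` A).
    by move=> mA; rewrite (pr_setID P mA mF) setDE ![_ `&` A]setIC.
  rewrite !prE// in PT FE *; rewrite -!EFinM in PT FE *; congr EFin.
  case: PT FE => + [+]; rewrite (split_pr D)// (split_pr C)// => H1 H2.
  by rewrite H2 mulrDl in H1; exact: addrI H1.
- move=> F mF tF FE; split; first by apply: bigcupT_measurable => n; case: (FE n).
  by apply: measure_bigcup_scale => // n; case: (FE n).
Qed.

End scaled_measures.

Section markov.
Variables (R : realType) (S : countType) (B K : finType).
Variables (d : measure_display) (Omega : measurableType d) (P : probability Omega R).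
Variables (l : B -> R) (N : B -> R -> Omega -> nat) (V : B -> nat -> S -> Omega -> K).
Variables (q : B -> S -> K -> R) (phi : B -> S -> K -> S) (X : R -> Omega -> S).
Hypothesis jX : marked_jump_process P l N V q phi X.
Variable b0 : B.

Let L := \sum_b l b.
Let p := unif_trans (jump_weight l q) (jump_move phi) L.

Let cylinders (s : R) : set (set Omega) :=
  [set E | exists (U : seq R) (g : R -> pred S),
     {subset U <= [pred u | 0 <= u <= s]} /\ E = [set o | all (fun u => g u (X u o)) U]].

Let cylinders_setI s : setI_closed (cylinders s).
Proof.
move=> _ _ [U [g [Us ->]]] [U' [g' [Us' ->]]].
exists (U ++ U'), (fun u z => ((u \in U) ==> g u z) && ((u \in U') ==> g' u z)); split.
  by move=> u; rewrite mem_cat => /orP[/Us|/Us'].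
apply/seteqP; split=> o /=.
  move=> [/allP gU /allP gU']; apply/allP => u _.
  by apply/andP; split; apply/implyP; [exact: gU|exact: gU'].
move=> /allP gUU'; split; apply/allP => u uU.
  have /gUU'/andP[/implyP gu _] : u \in U ++ U' by rewrite mem_cat uU.
  exact: gu.
have /gUU'/andP[_ /implyP gu'] : u \in U ++ U' by rewrite mem_cat uU orbT.
exact: gu'.
Qed.

Let cylinders_measurable s : cylinders s `<=` measurable.
Proof.
move=> _ [U [g [Us ->]]]; elim: U Us => [|u U IH] Us /=.
  by rewrite (_ : [set _ | _] = setT)//; apply/seteqP.
rewrite (_ : [set _ | _] = [set o | g u (X u o)] `&` [set o | all (fun u => g u (X u o)) U]).
  apply: measurableI; last by apply: IH => v vU; apply: Us; rewrite in_cons vU orbT.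
  have /andP[u0 _] := Us u (mem_head u U).
  exact: (measurable_rv (g u) (jump_rv jX u0)).
by apply/seteqP; split=> o /=; [move/andP|case=> -> ->].
Qed.

(** The initial state is fixed so that the grid can begin at 0. A constraint at time 0 is then a
    condition on [x0], both sides vanishing when it fails; the positive times among [s] and [U] are
    sorted without repetition to yield positive gaps. *)
Let markov_cylinder s t x y x0 E : 0 <= s -> 0 < t -> cylinders s E ->
  (P ([set o | X 0 o = x0] `&` (E `&` [set o | X s o = x] `&` [set o | X (s + t)%R o = y])) =
   P ([set o | X 0 o = x0] `&` (E `&` [set o | X s o = x])) * (p t x y)%:E)%E.
Proof.
move=> s0 t0 [U [g [Us ->]]].
(* The event at [s] is merged with the cylinder, so that the constraint at [s] pins the state. *)
pose g' u z := ((u \in U) ==> g u z) && ((u == s) ==> (z == x)).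
pose rest := sort <=%R (undup [seq u <- s :: U | 0 < u]).
have mem_rest u : (u \in rest) = (0 < u) && (u \in s :: U).
  by rewrite mem_sort mem_undup mem_filter.
have sU u : u \in s :: U -> 0 <= u <= s.
  by rewrite in_cons => /predU1P[->|/Us//]; rewrite s0 lexx.
have path_rest : path <%R 0 rest.
  rewrite lt_path_sortedE sort_lt_sorted undup_uniq andbT.
  by apply/allP => u; rewrite mem_rest => /andP[].
have last_rest : last 0 rest = s.
  apply/eqP; rewrite eq_le; apply/andP; split.
    have := mem_last 0 rest; rewrite in_cons => /predU1P[->//|].
    by rewrite mem_rest => /andP[_ /sU/andP[]].
  have [->|sn0] := eqVneq s 0.
    by apply: (path_le_last path_rest); rewrite mem_head.
  by apply: (path_le_last path_rest); rewrite in_cons mem_rest mem_head lt0r sn0 s0 orbT.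
have pastE o : X 0 o = x0 ->
    ([set o | all (fun u => g u (X u o)) U] `&` [set o | X s o = x]) o <->
    g' 0 x0 && all (fun u => g' u (X u o)) rest.
  move=> X0; split=> [[/= /allP gU Xs]|/andP[g0 /allP grest]].
    have g'P u : g' u (X u o).
      by apply/andP; split; apply/implyP; [exact: gU|move=> /eqP ->; apply/eqP].
    by rewrite -X0 g'P /=; apply/allP => u _.
  have g'P u : u \in s :: U -> g' u (X u o).
    move=> usU; have /andP[u0 _] := sU u usU.
    move: u0; rewrite le_eqVlt => /predU1P[<-|u0]; first by rewrite X0.
    by apply: grest; rewrite mem_rest u0.
  split=> /=; last by have /andP[_] := g'P s (mem_head _ _); rewrite eqxx => /eqP.
  apply/allP => u uU; have : u \in s :: U by rewrite in_cons uU orbT.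
  by move=> /g'P/andP[]; rewrite uU.
have [g0|g0] := boolP (g' 0 x0); last first.
  rewrite (_ : _ `&` _ = set0) ?measure0; last first.
    by apply/seteqP; split=> // o [X0 [/(pastE o X0)]]; rewrite (negbTE g0).
  rewrite (_ : _ `&` _ = set0) ?measure0 ?mul0e//.
  by apply/seteqP; split=> // o [X0 /(pastE o X0)]; rewrite (negbTE g0).
have gaps0 := gaps_gt0 g' path_rest.
have pin : forall z, g' s z -> z = x by move=> z /andP[_]; rewrite eqxx => /eqP.
have := markov_future jX b0 y gaps0 t0
  (fun k f => euler_value_gaps (jump_weight l q) (jump_move phi) L k f g0 last_rest pin).
rewrite future_rcons sum_gaps last_rest subr0 add0r future_gaps -/L -/p => prb.
have past_gaps : [set o | X 0 o = x0] `&` ([set o | all (fun u => g u (X u o)) U] `&` [set o | X s o = x])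
    = [set o | X 0 o = x0] `&` [set o | all (fun u => g' u (X u o)) rest].
  apply/seteqP; split=> o [X0 /=]; first by move=> /(pastE o X0)/andP[_].
  by move=> grest; split=> //; apply/(pastE o X0); rewrite g0.
have mX u z : 0 <= u -> measurable [set o | X u o = z] by move=> u0; exact: (jump_rv jX).
have mE : measurable ([set o | X 0 o = x0] `&` [set o | all (fun u => g' u (X u o)) rest]).
  rewrite -past_gaps; apply: measurableI; first exact: mX.
  apply: measurableI; last exact: mX.
  by apply: (@cylinders_measurable s); exists U, g.
rewrite setIA past_gaps !prE//.
  rewrite -EFinM -prb; congr (pr _ _)%:E; rewrite -setIA; congr (_ `&` (_ `&` _)).
  by apply/seteqP; split=> o /eqP.
by apply: measurableI => //; apply: mX; rewrite addr_ge0// ltW.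
Qed.

Let mX u x : 0 <= u -> measurable [set o | X u o = x].
Proof. by move=> u0; exact: (jump_rv jX). Qed.

Let L_gt0 : 0 < L. Proof. exact: total_rate_gt0 jX b0. Qed.
Let w0 j x : 0 <= jump_weight l q j x. Proof. exact: jump_weight_ge0 jX j x. Qed.
Let wL x : \sum_j jump_weight l q j x = L. Proof. exact: jump_weight_sum jX x. Qed.

Let markov_sigma s t x y E : 0 <= s -> 0 < t -> sigma_gen [set u | 0 <= u <= s] X E ->
  (P (E `&` ([set o | X s o = x] `&` [set o | X (s + t)%R o = y])) =
   P (E `&` [set o | X s o = x]) * (p t x y)%:E)%E.
Proof.
move=> s0 t0 sE; have st0 : 0 <= s + t by rewrite addr_ge0// ltW.
have mC := mX x s0; have mD := measurableI _ _ mC (mX y st0).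
have {}sE : <<s cylinders s >> E.
  apply: (smallest_sub _ _ sE); first exact: smallest_sigma_algebra.
  move=> _ [u us [Q ->]]; apply: sub_gen_smallest.
  exists [:: u], (fun _ z => `[<Q z>]); split=> [v|].
    by rewrite inE => /eqP ->.
  by apply/seteqP; split=> o /=; rewrite andbT => /asboolP.
apply: (dynkin_scale mC mD _ _ _ _ sE).
- exact: cylinders_setI.
- by exists [::], (fun _ _ => true); split=> //; apply/seteqP.
- exact: cylinders_measurable.
- move=> {sE}E cE; have mE := cylinders_measurable cE.
  (* The initial state has been fixed up to here; its countably many values, indexed by [pickle],
     are now summed over. *)
  have cover : \bigcup_n [set o | pickle (X 0 o) = n] = setT.
    by apply/seteqP; split=> // o _; exists (pickle (X 0 o)).
  have := @measure_bigcup_scale _ _ _ P (p t x y) _ _ (measurableI _ _ mE mC)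
    (measurableI _ _ mE mD) (fun n => [set o | pickle (X 0 o) = n]).
  rewrite cover !setTI; apply=> [n| |n].
  + exact: (measurable_rv (fun z => pickle z = n) (jump_rv jX (lexx 0))).
  + by move=> m n _ _ [v [/= <- <-]].
  + have [[x0 <-]|nx0] := pselect (exists x0 : S, pickle x0 = n).
      rewrite (_ : [set o | _] = [set o | X 0 o = x0]); last first.
        by apply/seteqP; split=> o /= => [/(pcan_inj pickleK)|->].
      by rewrite setIA; exact: markov_cylinder.
    rewrite (_ : [set o | _] = set0) ?set0I ?measure0 ?mul0e//.
    by apply/seteqP; split=> // o /= Xn; apply: nx0; exists (X 0 o).
Qed.

(** Rates are matched off the diagonal only, which allows the jump mechanism to contain moves that
    leave the state unchanged, such as potential services at empty queues. *)
Lemma marked_jump_process_markov (rate : S -> S -> R) :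
  (forall x y, x != y ->
    rate x y = \sum_b l b * \sum_(v | phi b x v == y) q b x v) ->
  markov_process P rate X.
Proof.
move=> rateE; split=> [t t0||].
- exact: jump_rv jX t t0.
- by apply: filterS (jump_path jX) => o; exact: driven_cadlag.
exists p; split; [exact: unif_trans_transition|apply: unif_trans_rates => //|].
  move=> x y xy; rewrite rateE//.
  rewrite -(pair_bigA _ (fun b v => jump_weight l q (b, v) x * (phi b x v == y)%:R)) /=.
  apply: eq_bigr => b _; rewrite mulr_sumr big_mkcond; apply: eq_bigr => v _.
  by rewrite /jump_weight /=; case: ifP => _; rewrite ?mulr1 ?mulr0.
(* The grids need a positive duration; at [t = 0] the transition function is the identity. *)
move=> s t E x y s0 t0 sE; rewrite -setIA; move: t0; rewrite le_eqVlt => /predU1P[<-|t0].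
  rewrite addr0 /p unif_trans_0//.
  have [->|xy] := eqVneq x y; first by rewrite setIid mule1.
  rewrite mule0 (_ : _ `&` _ = set0) ?measure0//.
  by apply/seteqP; split=> // o [_ [/= ->]] /eqP; rewrite (negbTE xy).
exact: markov_sigma.
Qed.

End markov.

(** * The coupling *)

HB.instance Definition _ := gen_eqMixin source.

Lemma ae_forall_countable (d : measure_display) (Omega : measurableType d) (R : realType)
    (P : probability Omega R) (T : countType) (Q : T -> Omega -> Prop) :
  (forall i, \forall w \ae P, Q i w) -> \forall w \ae P, forall i, Q i w.
Proof.
move=> aeQ.
have : \forall w \ae P, forall n : nat, if unpickle n is Some i then Q i w else True.
  by apply: ae_foralln => n; case: (unpickle n) => [i|]; [exact: aeQ|exact: aeW].
by apply: filterS => w Qw i; have := Qw (pickle i); rewrite pickleK.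
Qed.

Lemma mutually_independent_seq (d : measure_display) (Omega : measurableType d)
    (R : realType) (P : probability Omega R) (I : eqType) (F : I -> set (set Omega))
    (s : seq (I * set Omega)) :
  mutually_independent P F -> uniq [seq p.1 | p <- s] ->
  (forall p, p \in s -> F p.1 p.2) ->
  P (\big[setI/setT]_(p <- s) p.2) = (\prod_(p <- s) P p.2)%E.
Proof.
case: s => [|p0 s'] indep us Fs; first by rewrite !big_nil probability_setT.
set s := p0 :: s' in us Fs *.
rewrite !(big_nth p0) !big_mkord; apply: (indep _ (fun k => (nth p0 s k).1)).
  move=> i j /eqP; rewrite -!(nth_map p0 p0.1 fst)// nth_uniq ?size_map//.
  by move=> /eqP/val_inj.
by move=> k; exact/Fs/mem_nth.
Qed.

(** * Either network as a marked jump process *)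

Section policy_process.
Variables (R : realType) (c : nat) (lam : R) (a b : state c -> 'I_c -> 'I_c -> R).
Variables (d : measure_display) (Omega : measurableType d) (P : probability Omega R).
Variables (NA NS : R -> Omega -> nat) (K L : nat -> Omega -> 'I_c).
Variables (A B : nat -> state c -> 'I_c -> Omega -> 'I_c) (X Y : R -> Omega -> state c).
Hypotheses (c_gt0 : (0 < c)%N) (lam_gt0 : 0 < lam).
Hypothesis construction : coupling_construction P lam a b NA NS K L A B X Y.

Let F := source_sigma NA NS K L A B X Y.

Definition clock_rate (s : bool) : R := if s then c%:R else lam.
Definition clock (s : bool) := if s then NS else NA.
Definition clock_mark (s : bool) := if s then L else K.
Definition queue_move (s : bool) (x : state c) (ki : 'I_c * 'I_c) : state c :=
  if s then remove_task x ki.2 else add_task x ki.2.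

Let clock_source (s : bool) := if s then Services else Arrivals.
Let mark_source (s : bool) := if s then ServiceMark else ArrivalMark.
Let choice_source (s : bool) := if s then ServiceChoice else ArrivalChoice.

Variables (law : bool -> state c -> 'I_c -> 'I_c -> R).
Variables (choice : bool -> nat -> state c -> 'I_c -> Omega -> 'I_c) (Z : R -> Omega -> state c).

(** The mark retains the uniform draw besides the queue chosen by the policy: once the draw [k] is
    prescribed, the queue [sigma x k] is known and the event splits into two, on independent
    sources. *)
Definition choice_mark s n x w : 'I_c * 'I_c :=
  (clock_mark s n w, choice s n x (sigma x (clock_mark s n w)) w).

Definition choice_law (s : bool) (x : state c) (ki : 'I_c * 'I_c) : R :=
  c%:R^-1 * law s x (sigma x ki.1) ki.2.

Hypothesis Z_rv : forall t, 0 <= t -> discrete_rv (Z t).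
Hypothesis Z_initial : forall z, F Initial [set w | Z 0 w = z].
Hypothesis choice_rv : forall s n x j, discrete_rv (choice s n x j).
Hypothesis choice_sigma : forall s n x j i, F (choice_source s n) [set w | choice s n x j w = i].
Hypothesis choice_prob : forall s n x j i, P [set w | choice s n x j w = i] = (law s x j i)%:E.
Hypothesis Z_path : \forall w \ae P, driven_path (fun s => clock s ^~ w)
    (fun s n x => queue_move s x (choice_mark s n x w)) (Z ^~ w).

Let law_ge0 s x j i : 0 <= law s x j i.
Proof. by rewrite -lee_fin -(choice_prob s 0) measure_ge0. Qed.

Let law_sum s x j : \sum_i law s x j i = 1.
Proof.
have prT : pr P setT = 1 by rewrite /pr probability_setT.
have full : P (~` [set: Omega]) = 0%E by rewrite setCT measure0.
rewrite -prT (@pr_partition _ _ _ P setT measurableT full _ (choice s 0 x j)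
  (fun i => [set w | choice s 0 x j w = i]))//; last exact: choice_rv.
by apply: eq_bigr => i _; rewrite setTI /pr choice_prob.
Qed.

Let clock_poisson s : poisson_process P (clock_rate s) (clock s).
Proof. by case: s; [exact: constr_services construction|exact: constr_arrivals construction]. Qed.

Let mark_rv s n : discrete_rv (clock_mark s n).
Proof.
by case: s; [exact: constr_service_mark_rv construction n|
             exact: constr_arrival_mark_rv construction n].
Qed.

Let mark_prob s n k : P [set w | clock_mark s n w = k] = (c%:R^-1)%:E.
Proof.
by case: s; [exact: constr_service_mark_law construction n k|
             exact: constr_arrival_mark_law construction n k].
Qed.

Let mark_sigma s n k : F (mark_source s n) [set w | clock_mark s n w = k].
Proof.
by rewrite /F; case: s => /=; apply: sub_gen_smallest; exists tt => //; exists [set k].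
Qed.

Let increments_sigma s hk : all (fun p => 0 < p.1) hk ->
  F (clock_source s) (increments (clock s) 0 hk).
Proof.
have incr (N : R -> Omega -> nat) (t : R) : 0 <= t -> all (fun p => 0 < p.1) hk ->
    sigma_gen [set t | 0 <= t] N (increments N t hk).
  set G := [set E | exists2 j, [set t | 0 <= t] j & exists Q : set nat, E = N j @^-1` Q].
  have rv u : 0 <= u -> @discrete_rv _ (g_sigma_algebraType G) _ (N u).
    by move=> u0 x; apply: sub_gen_smallest; exists u => //; exists [set x].
  elim: hk t => [|[h k] hk IH] t t0 /=.
    by move=> _; exact: (@measurableT _ (g_sigma_algebraType G)).
  move=> /andP[h0 hk0]; have th0 : 0 <= t + h by rewrite addr_ge0// ltW.
  apply: (@measurableI _ (g_sigma_algebraType G)); last exact: IH.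
  exact: (measurable_rv2 (fun u v => u = (v + k)%N) (rv _ th0) (rv _ t0)).
by move=> hk0; case: s; exact: incr.
Qed.

Fixpoint mark_events (s : bool) (n : nat) (e : seq (state c * ('I_c * 'I_c))) :
    seq (source * set Omega) :=
  if e is (x, ki) :: e' then
    [:: (mark_source s n, [set w | clock_mark s n w = ki.1]),
        (choice_source s n, [set w | choice s n x (sigma x ki.1) w = ki.2]) &
        mark_events s n.+1 e']
  else [::].

Let mark_eventsE s n e :
  \big[setI/setT]_(p <- mark_events s n e) p.2 = marks_event (choice_mark s) n e.
Proof.
elim: e n => [|[x [k i]] e IH] n /=; first by rewrite big_nil.
rewrite !big_cons /= IH setIA; congr (_ `&` _); apply/seteqP.
by split=> w; [move=> [/= Kw Aw]; rewrite /choice_mark Kw Aw|case=> /= -> ->].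
Qed.

Let mark_events_sigma s n e p : p \in mark_events s n e -> F p.1 p.2.
Proof.
elim: e n => [|[x [k i]] e IH] n //=; rewrite !in_cons => /or3P[/eqP->|/eqP->|/IH//].
  exact: mark_sigma.
exact: choice_sigma.
Qed.

Let mark_events_prob s n e :
  (\prod_(p <- mark_events s n e) P p.2 = (\prod_(p <- e) choice_law s p.1 p.2)%:E)%E.
Proof.
elim: e n => [|[x [k i]] e IH] n /=; first by rewrite !big_nil.
by rewrite !big_cons /= IH mark_prob choice_prob muleA -!EFinM.
Qed.

(** Bookkeeping for distinctness: marks from index [n + 1] on share no source with the mark [n], nor
    with the marks of the other clock. *)
Let later (s : bool) (n : nat) (r : source) : bool :=
  match r with
  | ArrivalMark m | ArrivalChoice m => ~~ s && (n <= m)%N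
  | ServiceMark m | ServiceChoice m => s && (n <= m)%N
  | _ => false
  end.

Let mark_events_later s n e : all (later s n) [seq p.1 | p <- mark_events s n e].
Proof.
elim: e n => [|[x ki] e IH] n //=.
have -> : later s n (mark_source s n) by clear; case: s; rewrite /= leqnn.
have -> : later s n (choice_source s n) by clear; case: s; rewrite /= leqnn.
apply/allP => r /(allP (IH n.+1)); rewrite /later.
by case: r => //= m /andP[-> /ltnW].
Qed.

Let mark_events_uniq s n e : uniq [seq p.1 | p <- mark_events s n e].
Proof.
elim: e n => [|[x ki] e IH] n //=; rewrite IH andbT in_cons negb_or.
have nl r : r \in [seq p.1 | p <- mark_events s n.+1 e] -> later s n.+1 r.
  exact: (allP (mark_events_later s n.+1 e)).
apply/andP; split; last by apply/negP => /nl; case: s {nl IH}; rewrite /= ltnn.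
apply/andP; split; first by case: s {nl IH}; apply/eqP.
by apply/negP => /nl; case: s {nl IH}; rewrite /= ltnn.
Qed.

(** The event is an intersection over pairwise distinct sources: the initial state and, for each
    clock, its process and the draw and choice of every listed mark. Independence gives the
    product. *)
Let source_indep z (hk : bool -> seq (R * nat)) (e : bool -> seq (state c * ('I_c * 'I_c))) :
  (forall s, all (fun p => 0 < p.1) (hk s)) ->
  pr P ([set w | Z 0 w = z] `&`
    \bigcap_s (increments (clock s) 0 (hk s) `&` marks_event (choice_mark s) 0 (e s)))
  = pr P [set w | Z 0 w = z] *
    \prod_s ((\prod_(p <- hk s) poisson_pmf (clock_rate s * p.1) p.2) *
             \prod_(p <- e s) choice_law s p.1 p.2).
Proof.
move=> hk0.
pose block s := (clock_source s, increments (clock s) 0 (hk s)) :: mark_events s 0 (e s).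
pose events := (Initial, [set w | Z 0 w = z]) :: block true ++ block false.
have blockE s : \big[setI/setT]_(p <- block s) p.2 =
    increments (clock s) 0 (hk s) `&` marks_event (choice_mark s) 0 (e s).
  by rewrite big_cons mark_eventsE.
have block_prob s : (\prod_(p <- block s) P p.2 =
    ((\prod_(p <- hk s) poisson_pmf (clock_rate s * p.1) p.2) *
     \prod_(p <- e s) choice_law s p.1 p.2)%:E)%E.
  rewrite big_cons mark_events_prob EFinM /=; congr (_ * _)%E.
  exact: (poisson_increments_prob (clock_poisson s)).
have mZ : measurable [set w | Z 0 w = z] by exact: Z_rv.
have block_source s r : r \in [seq p.1 | p <- block s] -> (r == clock_source s) || later s 0 r.
  rewrite in_cons => /predU1P[->|/(allP (mark_events_later s 0 (e s)))->]; first by rewrite eqxx.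
  by rewrite orbT.
have block_uniq s : uniq [seq p.1 | p <- block s].
  rewrite /= mark_events_uniq andbT; apply/negP => /(allP (mark_events_later s 0 (e s))).
  by case: (s).
have us : uniq [seq p.1 | p <- events].
  rewrite map_cons map_cat cons_uniq cat_uniq !block_uniq mem_cat negb_or andTb andbT.
  apply/andP; split; last first.
    apply/hasPn => r /block_source r0; apply/negP => /block_source; move: r0.
    by case: r => [||m|m||m|m] /=; rewrite ?orbT ?orbF;
      do ?[by move=> /eqP|by move=> _ /eqP].
  by apply/andP; split; apply/negP => /block_source /=; rewrite orbF => /eqP.
have ms p : p \in events -> F p.1 p.2.
  rewrite in_cons mem_cat => /predU1P[->|/orP[]]; first exact: Z_initial.
    by rewrite in_cons => /predU1P[->|/mark_events_sigma//]; exact: increments_sigma.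
  by rewrite in_cons => /predU1P[->|/mark_events_sigma//]; exact: increments_sigma.
have := mutually_independent_seq (constr_independent construction) us ms.
rewrite !(big_cons _ _ (Initial, _)) !big_cat !blockE !block_prob /= (prE P mZ) -!EFinM.
rewrite (_ : \bigcap_s _ = increments (clock true) 0 (hk true) `&` marks_event (choice_mark true) 0 (e true)
   `&` (increments (clock false) 0 (hk false) `&` marks_event (choice_mark false) 0 (e false))); last first.
  apply/seteqP; split=> w; first by move=> ew; split; exact: ew.
  by move=> [e1 e0] [] _.
by rewrite big_bool => indep; rewrite {1}/pr indep.
Qed.

Lemma policy_marked_jump_process :
  marked_jump_process P clock_rate clock choice_mark choice_law queue_move Z.
Proof.
split=> //.
- by case=> //=; rewrite ltr0n.
- move=> s n x [k i].
  rewrite (_ : _ @^-1` _ = [set w | clock_mark s n w = k] `&` [set w | choice s n x (sigma x k) w = i]).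
    by apply: measurableI; [exact: mark_rv|exact: choice_rv].
  by apply/seteqP; split=> w /=; rewrite /choice_mark => -[-> ->].
- by move=> s x [k i]; rewrite mulr_ge0 ?invr_ge0.
- move=> s x; rewrite -(pair_bigA _ (fun k i => choice_law s x (k, i))) /=.
  under eq_bigr => k _ do rewrite /choice_law /= -mulr_sumr law_sum mulr1.
  by rewrite sumr_const card_ord -(mulr_natr c%:R^-1) mulVf// pnatr_eq0 -lt0n.
Qed.

End policy_process.

Lemma remove_task0 (c : nat) (x : state c) (i : 'I_c) : x i = 0%N -> remove_task x i = x.
Proof.
move=> xi; apply/ffunP => k; rewrite ffunE.
by have [->|_] := eqVneq k i; rewrite ?xi// subn0.
Qed.

Lemma remove_task_eq (c : nat) (x y : state c) (i : 'I_c) : x != y ->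
  (remove_task x i == y) = (x == add_task y i).
Proof.
move=> xy; apply/eqP/eqP => [rxy|->]; last first.
  by apply/ffunP => k; rewrite !ffunE addnK.
have xi : (0 < x i)%N.
  by rewrite lt0n; apply: contraNneq xy => xi; rewrite -rxy remove_task0.
apply/ffunP => k; rewrite -rxy !ffunE; case: eqVneq => [->|_]; last by rewrite subn0 addn0.
by rewrite subnK.
Qed.

Section policy_choices.
Variables (R : realType) (c : nat) (a b : state c -> 'I_c -> 'I_c -> R).

(* At an empty queue, remove_task does nothing, so that the services can be
   treated as if a choice were also made there. *)
Definition total_choice (s : bool) (x : state c) (j i : 'I_c) : R :=
  if s then if x j == 0%N then (i == j)%:R else b x j i else a x j i.

(** A uniform rank gives a uniform queue because [sigma x] is a bijection, and the factor [1 / c] of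
    the draw cancels against the service rate [c]. Choices made at empty queues only produce moves
    that fix [x], which [x != y] rules out. *)
Lemma lb_rateE (lam : R) x y : (0 < c)%N -> x != y ->
  lb_rate lam a b x y =
  \sum_s clock_rate c lam s *
    \sum_(v | queue_move s x v == y) choice_law total_choice s x v.
Proof.
move=> c0 xy; have cN0 : (c%:R : R) != 0 by rewrite pnatr_eq0 -lt0n.
have sumE s : \sum_(v | queue_move s x v == y) choice_law total_choice s x v =
    c%:R^-1 * \sum_(i | queue_move s x (i, i) == y) \sum_j total_choice s x j i.
  pose G k i := if queue_move s x (i, i) == y then c%:R^-1 * total_choice s x (sigma x k) i else 0 : R.
  transitivity (\sum_v G v.1 v.2).
    by rewrite big_mkcond; apply: eq_bigr => -[k i] _; rewrite /G /queue_move; case: (s).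
  rewrite -(pair_bigA _ G) exchange_big mulr_sumr [RHS]big_mkcond; apply: eq_bigr => i _ /=.
  rewrite /G; case: ifP => _; last by rewrite big1.
  by rewrite -mulr_sumr [in RHS](reindex_inj (@sigma_inj c x)).
rewrite /lb_rate big_bool !sumE /clock_rate /= [X in _ = X + _]mulrA (divff cN0) mul1r [RHS]addrC mulrA.
congr (_ + _).
  rewrite mulr_sumr; apply: eq_big => [i|i _ //]; first by rewrite eq_sym.
apply: eq_big => [i|i /eqP xi] /=; first by rewrite remove_task_eq.
rewrite [RHS](bigID (fun j => (0 < x j)%N)) /= [X in _ + X]big1 ?addr0 => [|j].
  by apply: eq_bigr => j; rewrite lt0n => /negbTE ->.
rewrite -eqn0Ngt => /eqP xj; rewrite xj eqxx; case: eqVneq => // ij.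
by move: xj; rewrite -ij xi ffunE eqxx addn1.
Qed.

End policy_choices.

Lemma driven_path_comp (R : realType) (B : finType) (S S' : Type) (N : B -> R -> nat)
    (f : B -> nat -> S -> S) (f' : B -> nat -> S' -> S') (h : S -> S') (X : R -> S) :
  (forall b n x, h (f b n x) = f' b n (h x)) ->
  driven_path N f X -> driven_path N f' (h \o X).
Proof.
move=> hf [cN jX kX]; split=> // [b t n /jX[x Xx Xt]|s t s0 st Nst]; last first.
  by rewrite /= (kX s t).
exists (h x); last by rewrite /= Xt hf.
by apply: filterS Xx => u /= ->.
Qed.

Section coupling.
Variables (R : realType) (c : nat) (lam : R) (a b : state c -> 'I_c -> 'I_c -> R).
Variables (d : measure_display) (Omega : measurableType d) (P : probability Omega R).
Variables (NA NS : R -> Omega -> nat) (K L : nat -> Omega -> 'I_c).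
Variables (A B : nat -> state c -> 'I_c -> Omega -> 'I_c) (X Y : R -> Omega -> state c).
Hypotheses (c_gt0 : (0 < c)%N) (lam_gt0 : 0 < lam) (policy : is_policy a b).
Hypothesis construction : coupling_construction P lam a b NA NS K L A B X Y.

Definition lb_choice (s : bool) n (x : state c) (j : 'I_c) (w : Omega) : 'I_c :=
  if s then if x j == 0%N then j else B n x j w else A n x j w.

Definition no_choice (s : bool) (n : nat) (x : state c) (j : 'I_c) (w : Omega) : 'I_c := j.

Lemma constant_choice (j i : 'I_c) :
  [set w : Omega | j = i] = if i == j then setT else set0.
Proof.
by have [->|/eqP ij] := eqVneq i j; apply/seteqP; split=> // w /= ji; apply: ij.
Qed.

Lemma lb_choice_rv s n x j : discrete_rv (lb_choice s n x j).
Proof.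
rewrite /lb_choice => i; case: s; last exact: constr_arrival_choice_rv construction n x j i.
have [xj|xj] := eqVneq (x j) 0%N; last first.
  by apply: (constr_service_choice_rv construction); rewrite lt0n.
by rewrite (_ : _ @^-1` _ = [set w | j = i])// constant_choice; case: ifP.
Qed.

Lemma lb_choice_law s n x j i :
  P [set w | lb_choice s n x j w = i] = (total_choice a b s x j i)%:E.
Proof.
rewrite /lb_choice /total_choice; case: s; last exact: constr_arrival_choice_law construction n x j i.
have [xj|xj] := eqVneq (x j) 0%N; last first.
  by apply: (constr_service_choice_law construction); rewrite lt0n.
by rewrite constant_choice; case: ifP => _; rewrite ?probability_setT ?measure0.
Qed.

Lemma no_choice_law s n x j i :
  P [set w | no_choice s n x j w = i] = (total_choice (@ur_choice R c) (@ur_choice R c) s x j i)%:E.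
Proof.
rewrite (constant_choice j i) /total_choice /ur_choice.
by rewrite !if_same; case: (i == j); rewrite ?probability_setT ?measure0.
Qed.

(** Choices that do not vary with the outcome are measurable for any source; this covers uniform
    routing and services at empty queues. *)
Let sigma_set (b' : bool) (G : set (set Omega)) : <<s G >> (if b' then setT else set0).
Proof.
by case: b'; [exact: (@measurableT _ (g_sigma_algebraType G))|
              exact: (@measurable0 _ (g_sigma_algebraType G))].
Qed.

Lemma lb_choice_sigma (s : bool) n x j i :
  source_sigma NA NS K L A B X Y ((if s then ServiceChoice else ArrivalChoice) n)
    [set w | lb_choice s n x j w = i].
Proof.
rewrite /lb_choice; case: s => /=; last first.
  by apply: sub_gen_smallest; exists (x, j) => //; exists [set i].
have [xj|xj] := eqVneq (x j) 0%N; first by rewrite constant_choice; exact: sigma_set.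
by apply: sub_gen_smallest; exists (x, j); [rewrite /= lt0n|exists [set i]].
Qed.

Lemma no_choice_sigma (s : bool) n x j i :
  source_sigma NA NS K L A B X Y ((if s then ServiceChoice else ArrivalChoice) n)
    [set w | no_choice s n x j w = i].
Proof. by rewrite (constant_choice j i); case: s => /=; exact: sigma_set. Qed.

Let step w s n (xy : state c * state c) :=
  (queue_move s xy.1 (choice_mark K L lb_choice s n xy.1 w),
   queue_move s xy.2 (choice_mark K L no_choice s n xy.2 w)).

(** The path of the pair is used three times: each projection is the path of one network, and the
    preorder is an invariant of the pair. *)
Let pair_path : \forall w \ae P, driven_path (fun s => clock NA NS s ^~ w) (step w)
  (fun t => (X t w, Y t w)).
Proof.
apply: filterS3 (constr_dynamics construction) (poisson_path (constr_arrivals construction))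
  (poisson_path (constr_services construction)) => w path NAw NSw; split.
- by case.
- case=> t n tn.
    have [x [y [Xx Yy Xt Yt]]] := path_service path tn.
    exists (x, y); first by apply: filterS2 Xx Yy => u -> ->.
    rewrite Xt Yt /step /queue_move /choice_mark /lb_choice /no_choice /=; congr pair.
      by case: ifP => // /eqP xj; rewrite remove_task0.
    by case: ifP => // /negbT; rewrite -eqn0Ngt => /eqP yj; rewrite remove_task0.
  have [x [y [Xx Yy Xt Yt]]] := path_arrival path tn.
  by exists (x, y); [apply: filterS2 Xx Yy => u -> ->|rewrite Xt Yt].
- move=> s t s0 st Nst.
  by have [-> ->] := path_constant path s0 st (Nst false) (Nst true).
Qed.

Lemma lb_process : lb_queue_length_process P lam a b X.
Proof.
have marked := policy_marked_jump_process c_gt0 lam_gt0 construction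
  (constr_X_rv construction) _ lb_choice_rv lb_choice_sigma lb_choice_law.
apply: (marked_jump_process_markov (marked _ _) true) => [z||x y xy].
- by apply: sub_gen_smallest; exists tt => //; exists [set xy | xy.1 = z].
- apply: filterS pair_path => w; exact: (driven_path_comp (h := fst)).
- by rewrite (lb_rateE a b lam c_gt0 xy).
Qed.

Lemma ur_process : ur_queue_length_process P lam Y.
Proof.
have marked := policy_marked_jump_process c_gt0 lam_gt0 construction
  (constr_Y_rv construction) _ _ no_choice_sigma no_choice_law.
apply: (marked_jump_process_markov (marked _ _ _) true) => [z|s n x j i||x y xy].
- by apply: sub_gen_smallest; exists tt => //; exists [set xy | xy.2 = z].
- by rewrite (_ : _ @^-1` _ = [set w | j = i])// constant_choice; case: ifP.
- apply: filterS pair_path => w; exact: (driven_path_comp (h := snd)).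
- by rewrite /= (lb_rateE _ _ lam c_gt0 xy).
Qed.

(** The support of the policy is known in law only: each forbidden value has probability zero, and
    since the indices are countably many, one null set discards them all. At an empty queue the
    inequality for services is trivial. *)
Let choice_support : \forall w \ae P, forall v : bool * nat * state c * 'I_c * 'I_c,
  let: (s, n, x, j, i) := v in lb_choice s n x j w = i ->
  if s then (x j <= x i)%N else (x i <= x j)%N.
Proof.
apply: ae_forall_countable => -[[[[s n] x] j] i].
have [good|bad] := boolP (if s then (x j <= x i)%N else (x i <= x j)%N); first exact: aeW.
exists [set w | lb_choice s n x j w = i]; split; first exact: lb_choice_rv.
  rewrite lb_choice_law /total_choice; congr EFin; apply/eqP; move: bad.
  case: s => bad; last by apply: contraNT bad => /(policy_arr_supp policy).
  have [xj|xj] := eqVneq (x j) 0%N; first by rewrite xj in bad.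
  by apply: contraNT bad; apply: (policy_srv_supp policy); rewrite lt0n.
by move=> w /= /not_implyP[].
Qed.

Lemma coupling_preceq : \forall w \ae P, preceq (X 0 w) (Y 0 w) ->
  forall t : R, 0 <= t -> preceq (X t w) (Y t w).
Proof.
apply: filterS2 pair_path choice_support => w path support XY0.
apply: (driven_invariant path (I := fun xy => preceq xy.1 xy.2)) => // s n [x y] /= xy.
have := support (s, n, x, sigma x (clock_mark K L s n w), _) erefl.
rewrite /queue_move /choice_mark /no_choice; case: s => /= si.
  exact: preceq_remove_task.
exact: preceq_add_task.
Qed.

End coupling.

Theorem theorem2 (R : realType) (c : nat) (lam : R)
    (a b : state c -> 'I_c -> 'I_c -> R)
    (d : measure_display) (Omega : measurableType d) (P : probability Omega R)
    (NA NS : R -> Omega -> nat) (K L : nat -> Omega -> 'I_c)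
    (A B : nat -> state c -> 'I_c -> Omega -> 'I_c)
    (X Y : R -> Omega -> state c) :
  (2 <= c)%N -> 0 < lam -> is_policy a b ->
  coupling_construction P lam a b NA NS K L A B X Y ->
  [/\ lb_queue_length_process P lam a b X,
      ur_queue_length_process P lam Y &
      \forall w \ae P,
        preceq (X 0 w) (Y 0 w) ->
        forall t : R, 0 <= t -> preceq (X t w) (Y t w)].
Proof.
move=> c2 lam0 policy construction; have c0 := ltnW c2.
split; [exact: (lb_process c0 lam0 construction)|exact: (ur_process c0 lam0 construction)|].
exact: (coupling_preceq policy construction).
Qed.
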